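(* Let $n\ge 2$, let $I\subset R$ be a complete intersection of codimension $n$ with homogeneous generators of degrees $d_1\le\cdots\le d_n$, let $K\subset I$ be generated by a regular sequence of length $n$ of homogeneous elements all of the same degree $e$, let $J=(K:I)$, and assume that the dual mapping cone resolution $\mathbf P$ of $R/J$ (described in the context) is minimal. If $M_1=e$, then $$e(R/J)\le\frac{\prod_{i=1}^n M_i}{n!},$$ where $M_i$ is the maximal shift in the $i$-th step of the minimal graded free resolution of $R/J$.
   Context: $R$ is a standard graded polynomial ring over a field, and $e(R/J)$ denotes the multiplicity of $R/J$ (while $e$ alone denotes the common degree of the generators of $K$). The inclusion $K\subset I$ induces a map $\phi$ from the Koszul resolution of $R/K$ to the Koszul resolution of $R/I$; the mapping cone of its dual (with the identity component in homological degree $0$ of $\phi$ cancelled) is a graded free resolution $\mathbf P$ of $R/J$ with $P_0=R$, $$P_i=R(-ie)^{\binom ni}\oplus\bigoplus_{|T|=n-i+1}R\Big(-\big(ne-\sum_{t\in T}d_t\big)\Big)\quad(1\le i\le n-1),\qquad P_n=\bigoplus_{t=1}^nR(-(ne-d_t)),$$ where $T$ ranges over subsets of $\{1,\dots,n\}$. One has $e\ge d_i$ for all $i$. When $\mathbf P$ is minimal, the maximal shifts are $M_i=\max\{ie,\ ne-\sum_{j=1}^{n-i+1} d_j\}$ for $1\le i\le n-1$ and $M_n=ne-d_1$. *)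

(* Defs.v *)
From Stdlib Require Import ClassicalEpsilon.
From HB Require Import structures.
From mathcomp Require Import all_boot all_order all_algebra.
From mathcomp.multinomials Require Export mpoly.

Set Implicit Arguments.
Unset Strict Implicit.
Unset Printing Implicit Defensive.

Import Order.TTheory GRing.Theory Num.Theory.
Local Open Scope ring_scope.

Section Ideals.

Variables (k : fieldType) (N : nat).
Notation R := {mpoly k[N]}.

Definition ideal_gen n (P : pred 'I_n) (f : 'I_n -> R) : R -> Prop :=
  fun p => exists c : 'I_n -> R, p = \sum_(j | P j) c j * f j.

Definition ideal n (f : 'I_n -> R) : R -> Prop := ideal_gen predT f.

Definition colon (K I : R -> Prop) : R -> Prop :=
  fun p => forall q, I q -> K (p * q).

Definition regular_sequence n (f : 'I_n -> R) : Prop :=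
  (forall (i : 'I_n) (p : R),
      ideal_gen [pred j : 'I_n | (j < i)%N] f (p * f i) ->
      ideal_gen [pred j : 'I_n | (j < i)%N] f p)
  /\ ~ ideal f 1.

(* Homogeneity in a possibly negative degree, where only 0 is homogeneous. *)
Definition homog_int (z : int) (p : R) : Prop :=
  match z with
  | Posz m => p \is m.-homog
  | Negz _ => p = 0
  end.

End Ideals.

Section Multiplicity.

Variables (k : fieldType) (N : nat).
Notation R := {mpoly k[N]}.
Variable J : R -> Prop.

(* dim_k (R/J)_t = h: the classes of h forms of degree t are a basis. *)
Definition hilbert_value (t h : nat) : Prop :=
  exists b : 'I_h -> R,
    (forall i, b i \is t.-homog) /\
    forall p : R, p \is t.-homog ->
      exists! c : 'rV[k]_h, J (p - \sum_(i < h) c 0 i *: b i).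

(* Q is the Hilbert polynomial of R/J. If Q = 0 then R/J has finite length and
   its multiplicity is that length; otherwise dim R/J = deg Q + 1 and the
   multiplicity is (deg Q)! times the leading coefficient of Q. *)
Definition is_multiplicity (m : rat) : Prop :=
  exists (H : nat -> nat) (Q : {poly rat}) (t0 : nat),
    [/\ forall t, hilbert_value t (H t),
        forall t, (t0 <= t)%N -> (H t)%:R = Q.[t%:R]
      & m = if Q == 0 then (\sum_(t < t0) H t)%N%:R
            else ((size Q).-1)`!%:R * lead_coef Q].

Definition multiplicity : rat := epsilon (inhabits 0) is_multiplicity.

End Multiplicity.

Section Resolutions.

Variables (k : fieldType) (N : nat).
Notation R := {mpoly k[N]}.

(* Graded free modules F_i = (+)_(b : gidx i) R(- gshift b), with maps
   F_(i+1) -> F_i sending the basis element b to \sum_c gdiff b c * c. *)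
Record gfree_seq := GFreeSeq {
  gidx : nat -> finType;
  gshift : forall i, gidx i -> int;
  gdiff : forall i, gidx i.+1 -> gidx i -> R
}.

Variable F : gfree_seq.

Definition gfree_map i (v : gidx F i.+1 -> R) : gidx F i -> R :=
  fun c => \sum_b v b * gdiff b c.

(* a b is a representative in R of the image of the basis element b of F_0
   under the augmentation F_0 -> R/J. *)
Definition graded_free_resolution (J : R -> Prop) : Prop :=
  (forall i (b : gidx F i.+1) (c : gidx F i),
      homog_int (gshift b - gshift c) (gdiff b c)) /\
  exists a : gidx F 0 -> R,
    [/\ forall b, homog_int (gshift b) (a b),
        exists v : gidx F 0 -> R, J (1 - \sum_b v b * a b),
        forall v : gidx F 0 -> R,
          J (\sum_b v b * a b) <-> exists w, v =1 gfree_map w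
      & forall i (v : gidx F i.+1 -> R),
          gfree_map v =1 (fun=> 0) <-> exists w, v =1 gfree_map w].

(* The image of every map lies in the irrelevant ideal times its target. *)
Definition minimal : Prop :=
  forall i (b : gidx F i.+1) (c : gidx F i), (gdiff b c)@_0%MM = 0.

Definition is_max_shift (i : nat) (M : int) : Prop :=
  (exists b : gidx F i, gshift b = M) /\
  (forall b : gidx F i, gshift b <= M).

End Resolutions.

Section DualMappingCone.

Variables (k : fieldType) (N n : nat).
Notation R := {mpoly k[N]}.

(* The Koszul complex has basis e_S, S a subset of {0, ..., n-1}, in homological
   degree #|S|; koszul f S T is the coefficient of e_T in the differential of
   e_S. *)
Definition koszul (f : 'I_n -> R) (S T : {set 'I_n}) : R :=
  \sum_(s in S | T == S :\ s) (-1) ^+ #|[set t in S | (t < s)%N]| * f s.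

(* phi S T is the coefficient of e_T in the image of e_S under a graded chain
   map from the Koszul complex of g (all degrees e) to that of f (degrees d),
   equal to the identity in homological degree 0. *)
Definition koszul_map (f g : 'I_n -> R) (d : 'I_n -> nat) (e : nat)
    (phi : {set 'I_n} -> {set 'I_n} -> R) : Prop :=
  [/\ forall S T : {set 'I_n}, #|S| != #|T| -> phi S T = 0,
      forall S T : {set 'I_n}, #|S| = #|T| ->
        homog_int ((#|S| * e)%N%:Z - (\sum_(t in T) d t)%N%:Z) (phi S T),
      phi set0 set0 = 1
    & forall S U, \sum_T phi S T * koszul f T U
                  = \sum_T koszul g S T * phi T U].

(* inl A is the dual of e_A in the Koszul complex of g, inr T the dual of e_T in
   that of f, twisted so that the dual of the top element of the former has
   homological degree and shift 0. Leaving out set0 cancels the identity component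
   of phi, whose dual maps inr set0 in degree n + 1 to inl set0 in degree n; since
   inr set0 is the only basis element of degree n + 1, the cancellation changes no
   other entry of the differential. *)
Definition cone_basis (i : nat) (x : {set 'I_n} + {set 'I_n}) : bool :=
  match x with
  | inl A => (A != set0) && (#|A| + i == n)%N
  | inr T => (T != set0) && (#|T| + i == n.+1)%N
  end.

Definition cone_shift (d : 'I_n -> nat) (e : nat)
    (x : {set 'I_n} + {set 'I_n}) : int :=
  match x with
  | inl A => (n * e)%N%:Z - (#|A| * e)%N%:Z
  | inr T => (n * e)%N%:Z - (\sum_(t in T) d t)%N%:Z
  end.

Definition cone_diff (f g : 'I_n -> R) (phi : {set 'I_n} -> {set 'I_n} -> R)
    (x y : {set 'I_n} + {set 'I_n}) : R :=
  match x, y with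
  | inl A, inl A' => koszul g A' A
  | inl _, inr _ => 0
  | inr T, inl A => phi A T
  | inr T, inr T' => - koszul f T' T
  end.

Definition dual_mapping_cone (f g : 'I_n -> R) (d : 'I_n -> nat) (e : nat)
    (phi : {set 'I_n} -> {set 'I_n} -> R) : gfree_seq k N :=
  @GFreeSeq k N
    (fun i => {x : {set 'I_n} + {set 'I_n} | cone_basis i x} : finType)
    (fun i b => cone_shift d e (val b))
    (fun i b c => cone_diff f g phi (val b) (val c)).

End DualMappingCone.

(* Main.v *)
Require Import Defs.
From Stdlib Require Import Classical ClassicalEpsilon.
From mathcomp Require Import all_boot all_order all_algebra.
From mathcomp Require Import ring lra zify.

Set Implicit Arguments.
Unset Strict Implicit.
Unset Printing Implicit Defensive.

Import Order.TTheory GRing.Theory Num.Theory.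
Local Open Scope ring_scope.

(** Let K be the ideal of the g_i and I that of the f_i, and let Delta be the
    component of phi in top degree n. The ideal J = K : I is linked to I through
    K, and everything rests on the two equalities J = K + (Delta) and
    K : Delta = I ([colon_eq_adjoin_Delta] and [colon_Delta]). Both come from
    comparing chain maps between Koszul complexes up to homotopy and looking at
    what a homotopy leaves in the last degree.

    They say that multiplication by Delta gives an exact sequence
    0 -> R/I(-s) -> R/K -> R/J -> 0 with s = ne - (d_1 + ... + d_n). On Hilbert
    series, with [d] = 1 + z + ... + z^(d-1), this gives the series
    ([e]^n - z^s [d_1] ... [d_n]) / (1 - z)^(N-n) for R/J, hence
    e(R/J) = e^n - d_1 ... d_n ([multiplicity_colon]).

    They also say that the map of dual Koszul complexes induced by phi is
    injective on R/I, with cokernel R/J, so that its mapping cone P resolves R/J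
    ([cone_resolves]). If F is another graded free resolution, then P -> F -> P
    is homotopic to the identity, and equal to it modulo the irrelevant ideal
    because P is minimal. Therefore all shifts of P occur in F
    ([minimal_shift]): one has M_i >= ie for i < n and M_n >= ne - d_1, while
    M_1 = e forces ne - (d_1 + ... + d_n) <= e.

    What remains is e^n - d_1 ... d_n <= e^(n-1) (ne - d_1) / n, that is
    e^(n-1) d_1 <= n d_1 ... d_n ([prod_degrees_ge]). Put u_i = 1 - d_i/e. These
    lie between 0 and 1 because d_i <= e ([degree_le]), they have sum at most 1,
    and u_1 is the largest, so that the sum of the others is at most 1 - 1/n; the
    product of the 1 - u_i for i > 1 is then at least 1/n. *)

(** * The Koszul complex of a regular sequence is acyclic *)

Section KoszulDifferential.

Variables (k : fieldType) (N n : nat).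
Notation R := {mpoly k[N]}.
Implicit Types (i : 'I_n) (f : 'I_n -> R) (S T U : {set 'I_n}).
Implicit Types (v w : {set 'I_n} -> R).

Definition koszul_sign (s : 'I_n) (U : {set 'I_n}) : R :=
  (-1) ^+ #|[set t in U | (t < s)%N]|.

(** Coefficient vectors are indexed by all subsets at once; the grading by
    cardinality comes back only when complexes are formed, so that acyclicity can
    be proved without keeping track of degrees. *)
Definition koszul_d f v U : R :=
  \sum_(s | s \notin U) koszul_sign s U * f s * v (s |: U).

Lemma koszul_dE f v U : \sum_S v S * koszul f S U = koszul_d f v U.
Proof.
rewrite /koszul_d.
under eq_bigr => S _ do rewrite /koszul big_distrr /=.
rewrite (exchange_big_dep xpredT) //= [RHS]big_mkcond /=.
apply: eq_bigr => s _; case: ifPn => [sU|]; last first.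
  rewrite negbK => sU; rewrite big1 // => S /andP[_ /eqP US].
  by move: sU; rewrite US setD11.
rewrite (big_pred1 (s |: U)) => [|S /=]; last first.
  apply/andP/eqP => [[sS /eqP->]|->]; first by rewrite setD1K.
  by rewrite setU11 setU1K.
rewrite mulrC; congr (_ * _ * _).
rewrite /koszul_sign; congr (_ ^+ #|pred_of_set _|).
by apply/setP=> t; rewrite !inE; case: eqP => // ->; rewrite ltnn !andbF.
Qed.

Lemma eq_koszul_d f v w : v =1 w -> koszul_d f v =1 koszul_d f w.
Proof. by move=> vw U; apply: eq_bigr => s _; rewrite vw. Qed.

Lemma koszul_dB f v w U :
  koszul_d f (fun S => v S - w S) U = koszul_d f v U - koszul_d f w U.
Proof. by rewrite -sumrB; apply: eq_bigr => s _; rewrite mulrBr. Qed.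

Lemma koszul_dZ f c v U :
  koszul_d f (fun S => c * v S) U = c * koszul_d f v U.
Proof. by rewrite big_distrr; apply: eq_bigr => s _; rewrite mulrCA. Qed.

Lemma koszul_sign_swap (s t : 'I_n) U : s \notin U -> t \notin U ->
  (s < t)%N ->
  koszul_sign s U * koszul_sign t (s |: U) =
    - (koszul_sign t U * koszul_sign s (t |: U)).
Proof.
move=> sU tU st; rewrite /koszul_sign.
have -> : [set x in s |: U | (x < t)%N] = s |: [set x in U | (x < t)%N].
  by apply/setP=> x; rewrite !inE; case: eqP => // ->; rewrite st.
have -> : [set x in t |: U | (x < s)%N] = [set x in U | (x < s)%N].
  apply/setP=> x; rewrite !inE; case: eqP => // ->.
  by rewrite ltnNge (ltnW st) /= andbF.
by rewrite cardsU1 !inE (negPf sU) /= exprD expr1 mulN1r mulrN mulrC.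
Qed.

(** Removing s and then t cancels against removing t and then s. The terms are
    paired along s < t: that the double sum equals its own opposite would not be
    enough in characteristic 2. *)
Lemma koszul_dd f v U : koszul_d f (koszul_d f v) U = 0.
Proof.
pose c s t : R :=
  if [&& s \notin U, t \notin U & s != t] then
    koszul_sign s U * f s * (koszul_sign t (s |: U) * f t * v (t |: (s |: U)))
  else 0.
have -> : koszul_d f (koszul_d f v) U = \sum_s \sum_t c s t.
  rewrite /koszul_d big_mkcond; apply: eq_bigr => s _.
  rewrite /c; case: ifP => sU /=; last by rewrite big1.
  rewrite big_distrr /= big_mkcond; apply: eq_bigr => t _.
  by rewrite !inE negb_or eq_sym andbC.
have cC (s t : 'I_n) : (s < t)%N -> c t s = - c s t.
  move=> st; rewrite /c [t == s]eq_sym andbCA.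
  case: ifP => [/and3P[sU tU _]|]; last by rewrite oppr0.
  rewrite (setUCA [set s]); set x := v _.
  transitivity (koszul_sign t U * koszul_sign s (t |: U) * (f s * f t * x)).
    by ring.
  by rewrite -[LHS]opprK -mulNr -koszul_sign_swap //; ring.
have cd s : c s s = 0 by rewrite /c eqxx !andbF.
transitivity (\sum_(s < n) \sum_(t < n | (s < t)%N) c s t
              + \sum_(s < n) \sum_(t < n | (t < s)%N) c s t).
  rewrite -big_split; apply: eq_bigr => s _ /=.
  rewrite [LHS](bigID (fun t : 'I_n => (s < t)%N)) /=; congr (_ + _).
  rewrite (bigD1 s) ?ltnn //= cd add0r; apply: eq_bigl => t.
  by rewrite -leqNgt ltn_neqAle andbC.
rewrite [X in _ + X](exchange_big_dep xpredT) //= -big_split big1 //= => s _.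
by rewrite -big_split big1 //= => t st; rewrite (cC s t) // subrr.
Qed.

Definition initial m : {set 'I_n} := [set j : 'I_n | (j < m)%N].

Definition supported m v := forall S, ~~ (S \subset initial m) -> v S = 0.

Lemma initialS (i : 'I_n) : initial i.+1 = i |: initial i.
Proof. by apply/setP=> j; rewrite !inE ltnS leq_eqVlt. Qed.

Lemma initial_notin (i : 'I_n) S : S \subset initial i -> i \notin S.
Proof. by move=> /subsetP sS; apply/negP => /sS; rewrite inE ltnn. Qed.

(** A vector supported on the subsets of {0, ..., i} has a component on the
    subsets without i, given by [below], and one on those with i, given by
    [above]; [join] puts two such components together. *)
Definition below (i : 'I_n) v S := if S \subset initial i then v S else 0.
Definition above (i : 'I_n) v S :=
  if S \subset initial i then v (i |: S) else 0.

Lemma supported_below i v : supported i (below i v).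
Proof. by move=> S /negPf; rewrite /below => ->. Qed.

Lemma supported_above i v : supported i (above i v).
Proof. by move=> S /negPf; rewrite /above => ->. Qed.

Lemma supported_koszul_d f m v : supported m v -> supported m (koszul_d f v).
Proof.
move=> sv S nS; rewrite /koszul_d big1 // => s _; rewrite sv ?mulr0 //.
by apply: contra nS; apply: subset_trans; rewrite subsetUr.
Qed.

Lemma koszul_d_above f (i : 'I_n) v : supported i.+1 v ->
  above i (koszul_d f v) =1 koszul_d f (above i v).
Proof.
move=> sv U; rewrite {1}/above; case: ifPn => sU; last first.
  by rewrite (supported_koszul_d _ (@supported_above i v)).
rewrite /koszul_d (bigID (fun s => s \in initial i)) /= addrC big1; last first.
  move=> s /andP[siU /negPf snp]; rewrite sv ?mulr0 // initialS.
  apply/negP => /subsetP/(_ s); rewrite !inE eqxx => /(_ isT).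
  move: siU snp; rewrite !inE negb_or => /andP[/negPf-> _] /= ->.
  by [].
rewrite add0r [RHS](bigID (fun s => s \in initial i)) /= [X in _ + X]big1 ?addr0.
  apply: eq_big => [s|s].
    rewrite !inE negb_or; case: eqP => //= ->.
    by rewrite ltnn andbF.
  rewrite !inE negb_or => /andP[/andP[si sU'] ltsi].
  rewrite /above subUset sub1set inE ltsi sU /= setUCA; congr (_ * _ * _).
  rewrite /koszul_sign; congr (_ ^+ #|pred_of_set _|).
  apply/setP=> t; rewrite !inE; case: eqP => //= ->.
  by rewrite ltnNge (ltnW ltsi) andbF.
move=> s /andP[_ nsp]; rewrite supported_above ?mulr0 //.
by rewrite subUset sub1set (negPf nsp).
Qed.

Lemma koszul_sign_initial (i : 'I_n) U :
  U \subset initial i -> koszul_sign i U = (-1) ^+ #|U|.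
Proof.
move=> /subsetP sU; rewrite /koszul_sign; congr (_ ^+ #|pred_of_set _|).
by apply/setP=> t; rewrite inE andb_idr // => /sU; rewrite inE.
Qed.

Lemma koszul_d_below f (i : 'I_n) v : supported i.+1 v ->
  below i (koszul_d f v) =1
    fun U => koszul_d f (below i v) U + (-1) ^+ #|U| * f i * above i v U.
Proof.
move=> sv U; rewrite {1}/below; case: ifPn => sU; last first.
  by rewrite (supported_koszul_d _ (@supported_below i v)) // supported_above //
    mulr0 addr0.
rewrite /koszul_d (bigD1 i) ?initial_notin //= addrC; congr (_ + _).
  rewrite [RHS](bigD1 i) ?initial_notin //= supported_below ?mulr0 ?add0r.
    apply: eq_bigr => s /andP[_ nsi]; rewrite /below; case: ifPn => // nS.
    rewrite sv // initialS; apply: contra nS => /subsetP sS; apply/subsetP => t.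
    move=> tS; have := sS t tS; rewrite !inE; case: eqP => // ti _.
    by move: tS; rewrite ti !inE eq_sym (negPf nsi) (negPf (initial_notin sU)).
  by rewrite subUset sub1set inE ltnn.
by rewrite /above sU koszul_sign_initial.
Qed.

Lemma below_above_eq (i : 'I_n) v w : supported i.+1 v -> supported i.+1 w ->
  below i v =1 below i w -> above i v =1 above i w -> v =1 w.
Proof.
move=> sv sw eb ea S.
case: (boolP (S \subset initial i.+1)) => [|nS]; last by rewrite sv // sw.
rewrite initialS => sS; case: (boolP (i \in S)) => iS.
  have sD : S :\ i \subset initial i by rewrite subDset.
  by have := ea (S :\ i); rewrite /above sD setD1K.
have sP : S \subset initial i.
  apply/subsetP => t tS; move/subsetP: sS => /(_ t tS); rewrite !inE.
  by case: eqP => // ti; rewrite -ti tS in iS.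
by have := eb S; rewrite /below sP.
Qed.

Definition join (i : 'I_n) v w S := if i \in S then w (S :\ i) else v S.

Lemma supported_join i v w :
  supported i v -> supported i w -> supported i.+1 (join i v w).
Proof.
move=> sv sw S; rewrite initialS => nS; rewrite /join; case: ifPn => iS.
  by apply: sw; rewrite subDset.
apply: sv; apply: contra nS => /subset_trans; apply; exact: subsetUr.
Qed.

Lemma below_join i v w : supported i v -> below i (join i v w) =1 v.
Proof.
move=> sv S; rewrite /below; case: ifPn => sS; last by rewrite sv.
by rewrite /join (negPf (initial_notin sS)).
Qed.

Lemma above_join i v w : supported i w -> above i (join i v w) =1 w.
Proof.
move=> sw S; rewrite /above; case: ifPn => sS; last by rewrite sw.
by rewrite /join setU11 setU1K ?initial_notin.
Qed.

Lemma ideal_gen0 (P : pred 'I_n) f : ideal_gen P f 0.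
Proof. by exists (fun=> 0); rewrite big1 // => j _; rewrite mul0r. Qed.

Lemma ideal_genD (P : pred 'I_n) f p q :
  ideal_gen P f p -> ideal_gen P f q -> ideal_gen P f (p + q).
Proof.
move=> [c ->] [c' ->]; exists (fun j => c j + c' j).
by rewrite -big_split; apply: eq_bigr => j _; rewrite mulrDl.
Qed.

Lemma ideal_genM (P : pred 'I_n) f p q :
  ideal_gen P f p -> ideal_gen P f (q * p).
Proof.
move=> [c ->]; exists (fun j => q * c j).
by rewrite big_distrr; apply: eq_bigr => j _ /=; rewrite mulrA.
Qed.

Lemma ideal_genN (P : pred 'I_n) f p : ideal_gen P f p -> ideal_gen P f (- p).
Proof. by move/ideal_genM => /(_ (-1)); rewrite mulN1r. Qed.

Lemma ideal_gen_sum (P : pred 'I_n) f (I : Type) (r : seq I) (A : pred I)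
    (F : I -> R) :
  (forall x, A x -> ideal_gen P f (F x)) ->
  ideal_gen P f (\sum_(x <- r | A x) F x).
Proof.
by move=> PF; elim/big_ind: _ => //; [exact: ideal_gen0|exact: ideal_genD].
Qed.

Lemma ideal_gen_in (P : pred 'I_n) f j : P j -> ideal_gen P f (f j).
Proof.
move=> Pj; exists (fun i => (i == j)%:R); rewrite (bigD1 j) //= eqxx mul1r.
by rewrite big1 ?addr0 // => i /andP[_ /negPf->]; rewrite mul0r.
Qed.

Lemma koszul_d_set0 f m v : supported m v ->
  ideal_gen [pred j : 'I_n | (j < m)%N] f (koszul_d f v set0).
Proof.
move=> sv; apply: ideal_gen_sum => s _.
case: (ltnP s m) => [sm|ms].
  by rewrite mulrAC; apply/ideal_genM/ideal_gen_in.
rewrite sv ?mulr0; first exact: ideal_gen0.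
by rewrite subUset sub1set inE ltnNge ms.
Qed.

Lemma ideal_gen_initialS (i : 'I_n) f p :
  ideal_gen [pred j : 'I_n | (j < i.+1)%N] f p ->
  exists c, ideal_gen [pred j : 'I_n | (j < i)%N] f (p - c * f i).
Proof.
move=> [c ->]; exists (c i); exists c.
rewrite (bigD1 i) /= ?ltnSn // addrC addrK; apply: eq_bigl => j.
by rewrite /= ltnS ltn_neqAle andbC.
Qed.

Definition single (x : {set 'I_n}) (c : R) : {set 'I_n} -> R :=
  fun S => if S == x then c else 0.

Lemma koszul_d_single0 f c : koszul_d f (single set0 c) =1 fun=> 0.
Proof.
move=> U; rewrite /koszul_d big1 // => s _; rewrite /single.
case: eqP => [/setP/(_ s)|]; last by rewrite mulr0.
by rewrite !inE eqxx.
Qed.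

(** Induction on m, by splitting off the last element f_i. A cycle then consists
    of a cycle [above] and of a vector [below] whose boundary is, up to signs,
    f_i times [above]. Regularity serves to see that the degree 0 component of
    [above] lies in the ideal of the elements before f_i, so that the induction
    hypothesis applies to it. *)
Lemma koszul_acyclic f m : regular_sequence f -> (m <= n)%N ->
  forall v, supported m v ->
  ideal_gen [pred j : 'I_n | (j < m)%N] f (v set0) ->
  koszul_d f v =1 (fun=> 0) ->
  exists2 w, supported m w & v =1 koszul_d f w.
Proof.
move=> [reg _]; elim: m => [|m IHm] lt_mn v sv v0 dv0.
  exists (fun=> 0) => // U; rewrite /koszul_d big1; last first.
    by move=> s _; rewrite mulr0.
  case: (eqVneq U set0) => [->|nU].
    by move: v0 => [c ->]; rewrite big_pred0.
  apply: sv; apply: contra nU => /subsetP sU; apply/eqP/setP=> t.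
  by rewrite inE; apply/negP => /sU; rewrite inE.
pose i := Ordinal lt_mn; have {}IHm := IHm (ltnW lt_mn).
have sv' : supported i.+1 v by [].
have da U : koszul_d f (above i v) U = 0.
  by rewrite -koszul_d_above // /above; case: ifP => // _; rewrite dv0.
have db U : koszul_d f (below i v) U + (-1) ^+ #|U| * f i * above i v U = 0.
  rewrite -(koszul_d_below f sv') /below; case: ifP => // _; exact: dv0.
have [|w1 sw1 vw1] := IHm _ (@supported_above i v) _ da.
  apply: (reg i); have := db set0; rewrite cards0 expr0 mul1r mulrC.
  move/eqP; rewrite addrC addr_eq0 => /eqP->.
  exact/ideal_genN/koszul_d_set0/supported_below.
have [c Hc] := ideal_gen_initialS v0 (i := i).
pose a := c - w1 set0.
(* [w1] may be changed by a multiple of the basis element of degree 0, which is a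
   cycle. The multiple [a] is chosen so that the degree 0 component of the cycle
   [u] below is [v set0 - c * f i], in the ideal of the elements before f_i. *)
pose w1' S := w1 S + single set0 a S.
have vw1' U : above i v U = koszul_d f w1' U.
  rewrite vw1 -[RHS](subrK (koszul_d f (single set0 a) U)) -koszul_dB.
  rewrite koszul_d_single0 addr0; apply: eq_koszul_d => S.
  by rewrite /w1' addrK.
have sw1' : supported i w1'.
  move=> S nS; rewrite /w1' sw1 // /single; case: eqP => [S0|].
    by rewrite S0 sub0set in nS.
  by rewrite addr0.
have w10 : w1' set0 = c by rewrite /w1' /single eqxx /a addrC subrK.
pose u U := below i v U - (-1) ^+ #|U| * f i * w1' U.
have su : supported m u.
  by move=> S nS; rewrite /u (@supported_below i) // sw1' // mulr0 subr0.
have [| |w0 sw0 uw0] := IHm u su.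
- by rewrite /u /below sub0set cards0 expr0 mul1r w10 mulrC.
- move=> U; rewrite -(db U) vw1'; transitivity
    (koszul_d f (below i v) U
     - koszul_d f (fun S => f i * ((-1) ^+ #|S| * w1' S)) U).
    rewrite -koszul_dB; apply: eq_koszul_d => S.
    by rewrite /u [f i * _]mulrCA mulrA.
  rewrite koszul_dZ; congr (_ + _); rewrite -mulrN mulrAC [RHS]mulrC.
  congr (_ * _).
  rewrite /koszul_d big_distrr -sumrN; apply: eq_bigr => s sU.
  by rewrite cardsU1 sU exprS /=; ring.
exists (join i w0 w1'); first exact: (@supported_join i).
have sj := @supported_join i _ _ sw0 sw1'.
apply: (below_above_eq sv' (supported_koszul_d _ sj)) => U.
  rewrite (koszul_d_below f sj) above_join // (eq_koszul_d _ (below_join _ _)) //.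
  by rewrite -uw0 /u subrK.
by rewrite (koszul_d_above f sj) (eq_koszul_d _ (above_join _ _)) // vw1'.
Qed.

End KoszulDifferential.
Arguments initial {n} m.

(** * Comparison of resolutions *)

(** Chain maps and homotopies are built one degree at a time; [good] is the
    condition under which the construction can be continued. *)
Lemma dependent_choice (T : nat -> Type) (good : forall i, T i -> Prop)
    (next : forall i, T i -> T i.+1 -> Prop) (x0 : T 0%N) :
  good 0%N x0 ->
  (forall i x, good i x -> exists y, good i.+1 y /\ next i x y) ->
  exists s : forall i, T i, s 0%N = x0 /\ forall i, next i (s i) (s i.+1).
Proof.
move=> g0 step.
have step' i (x : {x : T i | good i x}) :
    {y : {y : T i.+1 | good i.+1 y} | next i (sval x) (sval y)}.
  case: x => x gx /=; apply: constructive_indefinite_description.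
  by have [y [gy xy]] := step i x gx; exists (exist _ y gy).
pose s := fix s i : {x : T i | good i x} :=
  if i is j.+1 then sval (step' j (s j)) else exist _ x0 g0.
by exists (fun i => sval (s i)); split=> // i; exact: (svalP (step' i (s i))).
Qed.

Lemma row_choice (A B : Type) (P : A -> B -> Prop) :
  (forall a, exists b, P a b) -> exists h : A -> B, forall a, P a (h a).
Proof.
move=> e; exists (fun a => sval (constructive_indefinite_description _ (e a))).
by move=> a; exact: svalP.
Qed.

Section FunMatrices.

Variable R : comNzRingType.

(** Matrices are kept as functions on finite types, because the bases of the
    complexes are arbitrary finite types rather than ordinals. *)
Definition fmul (A B C : finType) (m : A -> B -> R) (m' : B -> C -> R) a c :=
  \sum_b m a b * m' b c.

Lemma fmulA (A B C D : finType) (m : A -> B -> R) (m' : B -> C -> R)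
    (m'' : C -> D -> R) a d :
  fmul (fmul m m') m'' a d = fmul m (fmul m' m'') a d.
Proof.
rewrite /fmul; under eq_bigr => c _ do rewrite big_distrl /=.
rewrite exchange_big; apply: eq_bigr => b _ /=; rewrite big_distrr /=.
by apply: eq_bigr => c _; rewrite mulrA.
Qed.

Lemma eq_fmul (A B C : finType) (m n : A -> B -> R) (m' n' : B -> C -> R) a c :
  m a =1 n a -> (forall b, m' b c = n' b c) -> fmul m m' a c = fmul n n' a c.
Proof. by move=> mn mn'; apply: eq_bigr => b _; rewrite mn mn'. Qed.

Lemma fmulBl (A B C : finType) (m n : A -> B -> R) (m' : B -> C -> R) a c :
  fmul (fun a b => m a b - n a b) m' a c = fmul m m' a c - fmul n m' a c.
Proof. by rewrite -sumrB; apply: eq_bigr => b _; rewrite mulrBl. Qed.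

Lemma fmulBr (A B C : finType) (m : A -> B -> R) (m' n' : B -> C -> R) a c :
  fmul m (fun b c => m' b c - n' b c) a c = fmul m m' a c - fmul m n' a c.
Proof. by rewrite -sumrB; apply: eq_bigr => b _; rewrite mulrBr. Qed.

Lemma fmul0r (A B C : finType) (m : A -> B -> R) (m' : B -> C -> R) a c :
  (forall b, m' b c = 0) -> fmul m m' a c = 0.
Proof. by move=> z; rewrite /fmul big1 // => b _; rewrite z mulr0. Qed.

Lemma fmul0l (A B C : finType) (m : A -> B -> R) (m' : B -> C -> R) a c :
  (forall b, m a b = 0) -> fmul m m' a c = 0.
Proof. by move=> z; rewrite /fmul big1 // => b _; rewrite z mul0r. Qed.

Definition fscalar (A : finType) (p : R) (a b : A) : R := p * (a == b)%:R.

Lemma fmul_scalarl (A B : finType) p (m : A -> B -> R) a b :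
  fmul (fscalar p) m a b = p * m a b.
Proof.
rewrite /fmul (bigD1 a) //= /fscalar eqxx mulr1 big1 ?addr0 // => c.
by rewrite eq_sym => /negPf->; rewrite mulr0 mul0r.
Qed.

Lemma fmul_scalarr (A B : finType) p (m : A -> B -> R) a b :
  fmul m (fscalar p) a b = p * m a b.
Proof.
rewrite /fmul (bigD1 b) //= /fscalar eqxx mulr1 mulrC big1 ?addr0 // => c.
by move=> /negPf->; rewrite !mulr0.
Qed.

End FunMatrices.

Section Comparison.

Variables (k : fieldType) (N : nat).
Notation R := {mpoly k[N]}.
Implicit Types (I J : R -> Prop) (C F : gfree_seq k N).

Definition is_ideal J : Prop :=
  [/\ J 0, forall p q, J p -> J q -> J (p + q) & forall p q, J p -> J (q * p)].

Lemma is_idealN J p : is_ideal J -> J p -> J (- p).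
Proof. by move=> [_ _ JM] /JM => /(_ (-1)); rewrite mulN1r. Qed.

Lemma is_ideal_sum J (A : finType) (c h : A -> R) : is_ideal J ->
  (forall a, J (h a)) -> J (\sum_a c a * h a).
Proof.
by move=> [J0 JD JM] Jh; elim/big_ind: _ => // a _; exact: JM.
Qed.

Definition is_complex C (a : gidx C 0 -> R) I : Prop :=
  (forall b : gidx C 1, I (\sum_c gdiff b c * a c)) /\
  (forall i (b : gidx C i.+2) (c : gidx C i),
     fmul (@gdiff _ _ C i.+1) (@gdiff _ _ C i) b c = 0).

Arguments is_complex C a I : clear implicits.

(** This is [graded_free_resolution] without the grading, for a given
    augmentation a; it is all that lifting and homotopy arguments use. *)
Definition resolves F (a : gidx F 0 -> R) J : Prop :=
  [/\ exists v : gidx F 0 -> R, J (1 - \sum_b v b * a b),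
      forall v : gidx F 0 -> R,
        J (\sum_b v b * a b) <-> exists w, v =1 gfree_map w
    & forall i (v : gidx F i.+1 -> R),
        gfree_map v =1 (fun=> 0) <-> exists w, v =1 gfree_map w].

Arguments resolves F a J : clear implicits.

Lemma gfree_map_delta F i (b : gidx F i.+1) :
  gfree_map (fun x => fscalar 1 b x) =1 gdiff b.
Proof. by move=> c; rewrite -[LHS]/(fmul _ _ b c) fmul_scalarl mul1r. Qed.

Lemma resolves_complex F a J : resolves F a J -> is_complex F a J.
Proof.
move=> [_ ex0 ex]; split=> [b|i b c].
  by apply/ex0; exists (fun x => fscalar 1 b x) => x; rewrite gfree_map_delta.
have [_ /(_ _)] := ex i (gdiff b); apply.
by exists (fun x => fscalar 1 b x) => x; rewrite gfree_map_delta.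
Qed.

Definition chain_map C F
    (al : forall i, gidx C i -> gidx F i -> R) : Prop :=
  forall i (b : gidx C i.+1) (c : gidx F i),
    fmul (al i.+1) (@gdiff _ _ F i) b c = fmul (@gdiff _ _ C i) (al i) b c.

(** The comparison theorem. A map in degree i extends to degree i + 1 when its
    composite with the differential of C takes values in the image of the
    differential of F, which exactness of F ensures. *)
Lemma lift_chain_map C F aC aF I J (p : R) :
  is_complex C aC I -> resolves F aF J -> is_ideal J ->
  (forall q, I q -> J (p * q)) ->
  exists al : forall i, gidx C i -> gidx F i -> R,
    chain_map al /\ forall b, J (p * aC b - \sum_c al 0%N b c * aF c).
Proof.
move=> [Ca Cdd] [[v Jv] ex0 ex] idJ pIJ; have [J0 JD JM] := idJ.
pose al0 (b : gidx C 0) (c : gidx F 0) := p * aC b * v c.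
have al0P b : J (p * aC b - \sum_c al0 b c * aF c).
  have := JM _ (p * aC b) Jv; rewrite mulrBr mulr1 big_distrr /=.
  by congr (J (_ - _)); apply: eq_bigr => c _; rewrite mulrA.
have [| |al [al0E alE]] := @dependent_choice
  (fun i => gidx C i -> gidx F i -> R)
  (fun i al => forall b, exists w, fmul (@gdiff _ _ C i) al b =1 gfree_map w)
  (fun i al al' => forall b c,
     fmul al' (@gdiff _ _ F i) b c = fmul (@gdiff _ _ C i) al b c) al0.
- move=> b; apply/ex0.
  have -> : \sum_c fmul (@gdiff _ _ C 0) al0 b c * aF c
          = p * (\sum_x gdiff b x * aC x)
            + \sum_x (- gdiff b x) * (p * aC x - \sum_c al0 x c * aF c).
    rewrite [X in _ = _ + X](eq_bigr (fun x => gdiff b x * (\sum_c al0 x c * aF c)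
       - p * (gdiff b x * aC x))); last by move=> x _; ring.
    rewrite sumrB big_distrr /= addrC subrK.
    by rewrite -[LHS]/(fmul (fmul _ al0) (fun c (_ : unit) => aF c) b tt) fmulA.
  by apply: JD; [exact/pIJ/Ca|exact: is_ideal_sum].
- move=> i al /row_choice[al' al'E]; exists al'; split; last first.
    by move=> b c; rewrite al'E.
  move=> b; apply/ex => c.
  rewrite -[LHS]/(fmul (fmul _ al') _ b c) fmulA.
  transitivity (fmul (@gdiff _ _ C i.+1) (fmul (@gdiff _ _ C i) al) b c).
    by apply: eq_fmul => // x; rewrite al'E.
  by rewrite -fmulA fmul0l.
by exists al; split=> [i b c|b]; rewrite ?alE // al0E.
Qed.

Definition null_homotopy C F (al : forall i, gidx C i -> gidx F i -> R)
    (h : forall i, gidx C i -> gidx F i.+1 -> R) : Prop :=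
  (forall b c, al 0%N b c = fmul (h 0%N) (@gdiff _ _ F 0) b c) /\
  (forall i b c, al i.+1 b c
     = fmul (@gdiff _ _ C i) (h i) b c + fmul (h i.+1) (@gdiff _ _ F i.+1) b c).

(** The uniqueness half of the comparison theorem: a chain map which is zero on
    the resolved quotients is null-homotopic. *)
Lemma null_homotopic C F aC aF I J
    (al : forall i, gidx C i -> gidx F i -> R) :
  is_complex C aC I -> resolves F aF J -> chain_map al ->
  (forall b, J (\sum_c al 0%N b c * aF c)) ->
  exists h, null_homotopy al h.
Proof.
move=> [_ Cdd] [_ ex0 ex] alE al0.
have /row_choice[h0 h0E] b : exists w, al 0%N b =1 gfree_map w by exact/ex0.
have [| |h [h00 hE]] := @dependent_choice
  (fun i => gidx C i -> gidx F i.+1 -> R)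
  (fun i h => forall b, exists w,
     (fun c => al i.+1 b c - fmul (@gdiff _ _ C i) h b c) =1 gfree_map w)
  (fun i h h' => forall b c, al i.+1 b c
     = fmul (@gdiff _ _ C i) h b c + fmul h' (@gdiff _ _ F i.+1) b c) h0.
- move=> b; apply/ex => c; rewrite -[LHS]/(fmul (fun b c => _ - _) _ b c).
  rewrite fmulBl alE fmulA (@eq_fmul _ _ _ _ _ (@gdiff _ _ C 0) _ (al 0%N)) //.
    by rewrite subrr.
  by move=> x; rewrite h0E.
- move=> i h /row_choice[h' h'E]; exists h'; split; last first.
    by move=> b c; have := h'E b c => /eqP; rewrite subr_eq addrC => /eqP.
  move=> b; apply/ex => c; rewrite -[LHS]/(fmul (fun b c => _ - _) _ b c).
  rewrite fmulBl alE fmulA -fmulBr.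
  transitivity (fmul (@gdiff _ _ C i.+1) (fmul (@gdiff _ _ C i) h) b c).
    by apply: eq_fmul => // x; rewrite -[fmul h' _ _ _]h'E subKr.
  by rewrite -fmulA fmul0l.
by exists h; split=> [b c|//]; rewrite h00 h0E.
Qed.

(** The form in which the comparison theorem is used for Koszul complexes and for
    minimal resolutions alike: going from G to C over the identity and back over p
    is homotopic to p. *)
Lemma round_trip_null_homotopic G C aG aC I K (p : R)
    (phi : forall i, gidx G i -> gidx C i -> R) :
  resolves G aG K -> is_ideal K -> is_complex C aC I ->
  (forall q, I q -> K (p * q)) -> chain_map phi ->
  (forall b, I (aG b - \sum_c phi 0%N b c * aC c)) ->
  exists (psi : forall i, gidx C i -> gidx G i -> R) h,
    null_homotopy (fun i b c => fmul (phi i) (psi i) b c - fscalar p b c) h.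
Proof.
move=> resG idK cC pIK phiE phi0.
have [psi [psiE psi0]] := lift_chain_map cC resG idK pIK.
exists psi; apply: (null_homotopic (resolves_complex resG) resG).
  move=> i b c; rewrite fmulBl fmulBr fmul_scalarl fmul_scalarr.
  congr (_ - _); rewrite fmulA -[RHS]fmulA.
  rewrite (eq_fmul (n := phi i.+1 : gidx G i.+1 -> _)
    (n' := fmul (@gdiff _ _ C i) (psi i))) // -fmulA.
  rewrite (eq_fmul (n := fmul (@gdiff _ _ G i) (phi i)) (n' := psi i)) //.
move=> b; have [K0 KD KM] := idK.
have -> : \sum_c (fmul (phi 0%N) (psi 0%N) b c - fscalar p b c) * aG c
  = \sum_x (- phi 0%N b x) * (p * aC x - \sum_c psi 0%N x c * aG c)
    + - (p * (aG b - \sum_c phi 0%N b c * aC c)).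
  rewrite -[LHS]/(fmul (fun b c => _ - _) (fun c (_ : unit) => aG c) b tt).
  rewrite fmulBl fmul_scalarl fmulA.
  rewrite [X in _ = X + _](eq_bigr (fun x => phi 0%N b x *
    (\sum_c psi 0%N x c * aG c) - p * (phi 0%N b x * aC x))); last first.
    by move=> x _; ring.
  rewrite sumrB -big_distrr /= -/(fmul _ _ _ _) /fmul; ring.
by apply: KD; [exact: is_ideal_sum|apply: is_idealN => //; exact/pIK].
Qed.

End Comparison.
Arguments is_complex {k N} C a I.
Arguments resolves {k N} F a J.

(** * Koszul complexes and their duals as resolutions *)

Section SeqOf.

Variables (k : fieldType) (N : nat).
Notation R := {mpoly k[N]}.

(** One square matrix D on a finite basis X, cut into free modules by the
    predicates B i. The Koszul complexes, their duals and the dual mapping cone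
    are all of this form. *)
Definition graded_seq (X : finType) (B : nat -> pred X) (sh : X -> int)
    (D : X -> X -> R) : gfree_seq k N :=
  @GFreeSeq k N (fun i => {x : X | B i x} : finType)
    (fun i b => sh (val b)) (fun i b c => D (val b) (val c)).

Lemma sum_sig (X : finType) (B : pred X) (F : X -> R) :
  \sum_(b : {x | B x}) F (val b) = \sum_(x | B x) F x.
Proof. by rewrite -(big_sub B F). Qed.

Lemma sum_sig_all (X : finType) (B : pred X) (F : X -> R) :
  (forall x, ~~ B x -> F x = 0) -> \sum_(b : {x | B x}) F (val b) = \sum_x F x.
Proof.
move=> F0; rewrite sum_sig [RHS](bigID B) /= [X in _ = _ + X]big1 ?addr0 //.
Qed.

Definition extend (X : finType) (B : pred X) (v : {x | B x} -> R) (x : X) : R :=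
  oapp v 0 (insub x).

Lemma extend_val (X : finType) (B : pred X) (v : {x | B x} -> R) b :
  extend v (val b) = v b.
Proof. by rewrite /extend valK. Qed.

Lemma extend_out (X : finType) (B : pred X) (v : {x | B x} -> R) x :
  ~~ B x -> extend v x = 0.
Proof. by move=> nB; rewrite /extend insubN. Qed.

Lemma sum_extend (X : finType) (B : pred X) (v : {x | B x} -> R) (h : X -> R) :
  \sum_b v b * h (val b) = \sum_x extend v x * h x.
Proof.
rewrite (bigID B) /= [X in _ + X]big1 => [|x nB]; last first.
  by rewrite extend_out // mul0r.
by rewrite addr0 -[RHS]sum_sig; apply: eq_bigr => b _; rewrite extend_val.
Qed.

Variables (X : finType) (B : nat -> pred X) (sh : X -> int) (D : X -> X -> R).
Variables (G : pred X) (deg : X -> nat) (x0 : X) (J : R -> Prop).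
Hypothesis BE : forall i x, B i x = G x && (deg x == i).
Hypothesis D_deg : forall x y, deg x != (deg y).+1 -> D x y = 0.
Hypothesis x0P : forall x, (G x && (deg x == 0%N)) = (x == x0).
Hypothesis DD : forall x z, G x -> G z -> \sum_(y | G y) D x y * D y z = 0.
Hypothesis JI : is_ideal J.
Hypothesis JD : forall x, G x -> J (D x x0).
Hypothesis exact : forall u : X -> R, (forall x, ~~ G x -> u x = 0) ->
  J (u x0) -> (forall y, G y -> \sum_x u x * D x y = 0) ->
  exists w : X -> R, (forall x, ~~ G x -> w x = 0) /\
    forall y, G y -> u y = \sum_x w x * D x y.

Notation F := (graded_seq B sh D).

Let sum_deg (w : X -> R) i y : (forall x, ~~ G x -> w x = 0) -> deg y = i ->
  \sum_x w x * D x y = \sum_(b : gidx F i.+1) w (val b) * D (val b) y.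
Proof.
move=> sw dy; rewrite (bigID (B i.+1)) /= [X in _ + X]big1 ?addr0; last first.
  move=> x; rewrite BE negb_and => /orP[nG|nd]; first by rewrite sw // mul0r.
  by rewrite D_deg ?mulr0 // dy.
by rewrite -[LHS]sum_sig.
Qed.

Let G_x0 : G x0 && (deg x0 == 0%N). Proof. by rewrite x0P. Qed.

Let extend_G i (v : gidx F i -> R) x : ~~ G x -> extend v x = 0.
Proof. by move=> nG; rewrite extend_out // BE (negPf nG). Qed.

Let gfree_mapE i (v : gidx F i.+1 -> R) c :
  gfree_map v c = \sum_x extend v x * D x (val c).
Proof. by rewrite -(sum_extend v (fun x => D x (val c))). Qed.

Let extend_cycle i (v : gidx F i.+1 -> R) : gfree_map v =1 (fun=> 0) ->
  forall y, G y -> \sum_x extend v x * D x y = 0.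
Proof.
move=> v0 y Gy; case: (eqVneq (deg y) i) => [dy|ndy].
  have By : B i y by rewrite BE Gy dy /=.
  by have := v0 (exist _ y By); rewrite gfree_mapE.
rewrite big1 // => x _; case: (boolP (B i.+1 x)) => [|nB]; last first.
  by rewrite extend_out // mul0r.
rewrite BE => /andP[_ /eqP dx]; rewrite D_deg ?mulr0 // dx eqSS eq_sym.
by [].
Qed.

(** Since D lowers the degree by one, exactness for vectors on the whole basis
    passes to each degree: the preimage found for a homogeneous vector can be
    truncated. G selects the basis elements that belong to the complex, and x0 is
    the only one of degree 0. *)
Lemma graded_seq_resolves : resolves F (fun=> 1) J.
Proof.
have [J0 JA JM] := JI; have [Gx0 /eqP dx0] := andP G_x0.
have aug (v : gidx F 0 -> R) : \sum_b v b * 1 = extend v x0.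
  rewrite (sum_extend v (fun=> 1)) (bigD1 x0) //= mulr1 big1 ?addr0 // => x.
  by rewrite -x0P -BE => nB; rewrite extend_out // mul0r.
split=> [|v|i v].
- exists (fun=> 1); rewrite aug; have B0 : B 0%N x0 by rewrite BE Gx0 dx0.
  by rewrite (extend_val (fun=> 1) (exist _ x0 B0)) subrr.
- rewrite aug; split=> [Jv|[w vw]]; last first.
    have B0 : B 0%N x0 by rewrite BE Gx0 dx0.
    rewrite (extend_val v (exist _ x0 B0)) vw.
    apply: is_ideal_sum => // x; apply: JD.
    by have := valP x; rewrite BE => /andP[].
  have [||w [sw wE]] := exact _ Jv; first exact: extend_G.
    move=> y Gy; rewrite big1 // => x _.
    case: (boolP (B 0%N x)) => [|nB]; last by rewrite extend_out // mul0r.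
    by rewrite BE => /andP[_ /eqP dx]; rewrite D_deg ?mulr0 // dx.
  exists (fun b => w (val b)) => c.
  have := valP c; rewrite BE => /andP[Gc /eqP dc].
  by rewrite -(extend_val v) wE // (sum_deg _ dc).
split=> [v0|[w vw] c].
  have [|||w [sw wE]] := exact (u := extend v); first exact: extend_G.
  - by rewrite extend_out // BE dx0 andbF.
  - exact: extend_cycle.
  exists (fun b => w (val b)) => c.
  have := valP c; rewrite BE => /andP[Gc /eqP dc].
  by rewrite -(extend_val v) wE // (sum_deg _ dc).
have := valP c; rewrite BE => /andP[Gc /eqP dc].
rewrite /gfree_map; under eq_bigr => b _ do rewrite vw.
rewrite -[LHS]/(fmul (fun _ b => gfree_map w b) _ tt c).
rewrite -[LHS]/(fmul (fmul (fun _ b => w b) _) _ tt c) fmulA fmul0r // => b.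
have := valP b; rewrite BE => /andP[Gb _].
rewrite -[RHS](DD Gb Gc) /fmul /= [RHS](bigID (B i.+1)) /= [X in _ + X]big1.
  rewrite addr0 (eq_bigl (B i.+1)); last first.
    by move=> y; rewrite BE; case: (G y).
  exact: (sum_sig (B i.+1) (fun x => D (val b) x * D x (val c))).
move=> y /andP[Gy]; rewrite BE Gy /= => nd.
by rewrite [X in _ * X]D_deg ?mulr0 // dc.
Qed.

End SeqOf.

Section Koszul.

Variables (k : fieldType) (N n : nat).
Notation R := {mpoly k[N]}.
Implicit Types (f : 'I_n -> R) (S T U A : {set 'I_n}) (v w : {set 'I_n} -> R).

Lemma koszul_eq0 f S T : ~~ ((T \subset S) && (#|S| == #|T|.+1)) ->
  koszul f S T = 0.
Proof.
move=> h; rewrite /koszul big1 // => s /andP[sS /eqP TE]; case/negP: h.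
by rewrite TE subD1set (cardsD1 s) sS add1n eqxx.
Qed.

Lemma koszul_card f S T : #|S| != #|T|.+1 -> koszul f S T = 0.
Proof. by move=> h; rewrite koszul_eq0 // (negPf h) andbF. Qed.

Lemma koszul_koszul f S U : \sum_T koszul f S T * koszul f T U = 0.
Proof.
pose e1 T : R := (S == T)%:R.
have kE T : koszul f S T = koszul_d f e1 T.
  rewrite -koszul_dE (bigD1 S) //= /e1 eqxx mul1r big1 ?addr0 // => V nV.
  by rewrite eq_sym (negPf nV) mul0r.
by rewrite koszul_dE (eq_koszul_d _ kE) koszul_dd.
Qed.

Lemma idealE f p : ideal f p <-> ideal_gen [pred j : 'I_n | (j < n)%N] f p.
Proof.
have E (c : 'I_n -> R) :
    \sum_(j < n | (j < n)%N) c j * f j = \sum_(j : 'I_n) c j * f j.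
  by apply: eq_bigl => j; rewrite ltn_ord.
by split=> -[c ->]; exists c; rewrite ?E // -E.
Qed.

Lemma is_ideal_gen (P : pred 'I_n) f : is_ideal (ideal_gen P f).
Proof.
by split=> [|p q|p q]; [exact: ideal_gen0|exact: ideal_genD|exact: ideal_genM].
Qed.

Lemma is_ideal_ideal f : is_ideal (ideal f). Proof. exact: is_ideal_gen. Qed.

Lemma koszul_ideal f m S T : S \subset initial m ->
  ideal_gen [pred j : 'I_n | (j < m)%N] f (koszul f S T).
Proof.
move=> /subsetP sS; apply: ideal_gen_sum => s /andP[/sS sm _].
by apply/ideal_genM/ideal_gen_in; rewrite inE in sm.
Qed.

Lemma subset_initial_n S : S \subset initial n.
Proof. by apply/subsetP => i _; rewrite inE. Qed.

(** The Koszul complex of the first m elements of f. *)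
Definition koszul_seq m f : gfree_seq k N :=
  graded_seq (fun i S => (S \subset initial m) && (#|S| == i)) (fun=> 0)
    (koszul f).

Lemma koszul_seq_resolves m f : regular_sequence f -> (m <= n)%N ->
  resolves (koszul_seq m f) (fun=> 1) (ideal_gen [pred j : 'I_n | (j < m)%N] f).
Proof.
move=> reg le_mn.
apply: (@graded_seq_resolves _ _ _ _ _ _ _ (fun S => #|S|) set0) => //.
- by move=> x y; exact: koszul_card.
- by move=> S; rewrite cards_eq0; case: eqP => [->|]; rewrite ?sub0set ?andbF.
- move=> S U sS sU; rewrite -[RHS](koszul_koszul f S U).
  rewrite [RHS](bigID (fun T => T \subset initial m)) /= [X in _ + X]big1 ?addr0//.
  move=> T nT; rewrite koszul_eq0 ?mul0r //; apply: contra nT => /andP[TS _].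
  exact: subset_trans TS sS.
- exact: is_ideal_gen.
- by move=> S; exact: koszul_ideal.
move=> u su u0 du; have [U|w sw uw] := koszul_acyclic reg le_mn su u0.
  rewrite -koszul_dE; case: (boolP (U \subset initial m)) => [/du//|nU].
  rewrite big1 // => S _; case: (boolP (S \subset initial m)) => sS; last first.
    by rewrite su // mul0r.
  rewrite koszul_eq0 ?mulr0 //; apply: contra nU => /andP[US _].
  exact: subset_trans US sS.
by exists w; split=> // y _; rewrite uw koszul_dE.
Qed.

Lemma card_initial m : (m <= n)%N -> #|@initial n m| = m.
Proof.
move=> le_mn; rewrite -sum1_card (eq_bigl (fun i : 'I_n => (i < m)%N)).
  by rewrite (big_ord_narrow le_mn) sum1_card card_ord.
by move=> i; rewrite inE.
Qed.

(** The signs of the self-duality of the Koszul complex. *)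
Definition set_sign S : R := \prod_(s in S) (-1) ^+ s.

Lemma set_sign_sqr S : set_sign S * set_sign S = 1.
Proof.
rewrite /set_sign -big_split big1 //= => s _.
by rewrite -exprD addnn -mul2n exprM sqrrN expr1n expr1n.
Qed.

(** Taking complements turns the Koszul matrix into its transpose, up to signs:
    for s outside T, the elements below s in T and in the complement of T are s in
    number altogether. *)
Lemma koszul_compl f S T :
  koszul f (~: T) (~: S) = set_sign S * set_sign T * koszul f S T.
Proof.
have compl s : (~: S == ~: T :\ s) = (S == s |: T).
  by rewrite setDE -setCU setUC (inj_eq (@setC_inj _)).
rewrite /koszul big_distrr /=; apply: eq_big => s.
  rewrite compl inE; apply/andP/andP => -[sT /eqP E].
    by rewrite E setU11 setU1K.
  by rewrite E setD1K // !inE eqxx.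
rewrite compl inE => /andP[sT /eqP ->].
have -> : set_sign (s |: T) = (-1) ^+ s * set_sign T.
  by rewrite /set_sign big_setU1.
rewrite -!mulrA [set_sign T * _]mulrA set_sign_sqr mul1r mulrA; congr (_ * _).
have -> : [set t in s |: T | (t < s)%N] = [set t in T | (t < s)%N].
  by apply/setP=> t; rewrite !inE; case: eqP => // ->; rewrite ltnn !andbF.
set a := #|_|; set b := #|_|.
have -> : nat_of_ord s = (b + a)%N.
  rewrite -(card_initial (ltnW (ltn_ord s))) -(cardsID T) /a /b.
  by congr (_ + _)%N; congr #|pred_of_set _|; apply/setP=> t; rewrite !inE andbC.
by rewrite addnC -exprD -addnA addnn -mul2n exprD exprM sqrrN expr1n expr1n mulr1.
Qed.

Definition twist v S : R := set_sign S * v (~: S).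
Definition untwist v S : R := set_sign (~: S) * v (~: S).

Lemma twistK v : twist (untwist v) =1 v.
Proof. by move=> S; rewrite /twist /untwist setCK mulrA set_sign_sqr mul1r. Qed.

Lemma untwistK v : untwist (twist v) =1 v.
Proof. by move=> S; rewrite /twist /untwist setCK mulrA set_sign_sqr mul1r. Qed.

Definition dual_koszul_d f v A := \sum_S v S * koszul f A S.

Lemma dual_koszul_dE f v : dual_koszul_d f v =1 untwist (koszul_d f (twist v)).
Proof.
move=> A; rewrite /untwist -koszul_dE big_distrr /=.
rewrite [LHS](reindex_inj (@setC_inj _)); apply: eq_bigr => S _ /=.
by rewrite -[in LHS](setCK A) koszul_compl /twist; ring.
Qed.

Lemma dual_koszul_acyclic f v : regular_sequence f -> ideal f (v setT) ->
  dual_koszul_d f v =1 (fun=> 0) -> exists w, v =1 dual_koszul_d f w.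
Proof.
move=> reg vT dv.
have [| |S|w _ vw] := koszul_acyclic (v := twist v) reg (leqnn n).
- by move=> S; rewrite subset_initial_n.
- by apply/idealE; rewrite /twist setC0; apply: ideal_genM.
- have := dv (~: S); rewrite dual_koszul_dE /untwist setCK.
  move=> /(congr1 ( *%R (set_sign S))).
  by rewrite mulrA set_sign_sqr mul1r mulr0.
exists (untwist w) => A.
rewrite dual_koszul_dE (_ : untwist _ A = untwist (twist v) A).
  by rewrite untwistK.
rewrite /untwist; congr (_ * _).
by rewrite [RHS]vw; apply: eq_koszul_d; exact: twistK.
Qed.

Lemma dual_koszul_dd f v A : dual_koszul_d f (dual_koszul_d f v) A = 0.
Proof.
rewrite /dual_koszul_d; under eq_bigr => S _ do rewrite big_distrl /=.
rewrite exchange_big big1 //= => T _.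
transitivity (v T * \sum_S koszul f A S * koszul f S T).
  by rewrite big_distrr /=; apply: eq_bigr => S _; ring.
by rewrite koszul_koszul mulr0.
Qed.

Definition dual_koszul_seq f : gfree_seq k N :=
  graded_seq (fun i S => (n - #|S|)%N == i) (fun=> 0) (fun S T => koszul f T S).

Lemma dual_koszul_seq_resolves f : regular_sequence f ->
  resolves (dual_koszul_seq f) (fun=> 1) (ideal f).
Proof.
move=> reg; have card_n S : (#|S| <= n)%N.
  by rewrite -[X in (_ <= X)%N]card_ord max_card.
apply: (@graded_seq_resolves _ _ _ _ _ _ xpredT (fun S => (n - #|S|)%N) setT)
  => //.
- move=> S T ST; rewrite koszul_card //; apply: contra ST => /eqP E.
  by have := card_n T; rewrite E => lt; rewrite subnS prednK // subn_gt0.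
- move=> S; rewrite /= subn_eq0; apply/idP/eqP => [le|->]; last first.
    by rewrite cardsT card_ord.
  by apply/eqP; rewrite eqEcard subsetT cardsT card_ord.
- move=> S U _ _; rewrite -[RHS](koszul_koszul f U S).
  by apply: eq_bigr => T _; rewrite mulrC.
- exact: is_ideal_ideal.
- by move=> S _; apply/idealE/koszul_ideal/subset_initial_n.
move=> u _ uT du; have [||w uw] := @dual_koszul_acyclic f u reg => //.
  by move=> A; exact: du.
by exists w; split=> // y _; exact: uw.
Qed.

End Koszul.

(** * Linkage: the colon ideal and the top component of phi *)

Section Linkage.

Variables (k : fieldType) (N n : nat).
Notation R := {mpoly k[N]}.
Implicit Types (S T U A : {set 'I_n}).

Lemma initial_full m S : (m < n)%N -> S \subset initial m -> #|S| != n.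
Proof.
move=> lt_mn sS; apply/negP => /eqP cS.
have := subset_leq_card sS; rewrite cS card_initial; last exact: ltnW.
by rewrite leqNgt lt_mn.
Qed.

Lemma card_n S : (#|S| == n) = (S == setT).
Proof.
apply/eqP/eqP => [cS|->]; last by rewrite cardsT card_ord.
by apply/eqP; rewrite eqEcard subsetT cardsT card_ord cS /=.
Qed.

Lemma koszul_setT (f : 'I_n -> R) (i : 'I_n) :
  exists b : bool, koszul f setT (~: [set i]) = (-1) ^+ b * f i.
Proof.
exists (odd #|[set t in [set: 'I_n] | (t < i)%N]|).
rewrite signr_odd /koszul (big_pred1 i) // => s /=; rewrite inE /=.
by rewrite setTD (inj_eq (@setC_inj _)) (inj_eq set1_inj) eq_sym.
Qed.

Variables (f g : 'I_n -> R).
Hypothesis f_regular : regular_sequence f.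
Hypothesis g_regular : regular_sequence g.

(** Multiplication by p lifts to a map from the Koszul complex of f to that of g.
    On the Koszul complex of g its composite with phi is homotopic to p, and in
    the top degree n the homotopy contributes elements of the ideal of g only. *)
Lemma colon_lift m p : (m <= n)%N ->
  forall phi : forall i, gidx (koszul_seq n g) i -> gidx (koszul_seq m f) i -> R,
  chain_map phi ->
  (forall b, ideal_gen [pred j : 'I_n | (j < m)%N] f
               (1 - \sum_c phi 0%N b c * 1)) ->
  (forall q, ideal_gen [pred j : 'I_n | (j < m)%N] f q -> ideal g (p * q)) ->
  forall i (b : gidx (koszul_seq n g) i.+1), i.+1 = n -> exists psi,
    ideal g (p - \sum_c phi i.+1 b c * psi c).
Proof.
move=> le_mn phi phiE phi0 pK i b iE.
have resg := koszul_seq_resolves g_regular (leqnn n).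
have resf := koszul_seq_resolves f_regular le_mn.
have idg := is_ideal_gen [pred j : 'I_n | (j < n)%N] g.
have [|psi [h [_ hE]]] := round_trip_null_homotopic resg idg
  (resolves_complex resf) (p := p) _ phiE phi0.
  by move=> q /pK /idealE.
exists (fun c => psi i.+1 c b); apply/idealE.
have := hE i b b; rewrite /fscalar eqxx mulr1 [fmul (h i.+1) _ _ _]big1; last first.
  move=> c _; have := valP c => /= /andP[_ /eqP cE].
  have := max_card [in val c]; rewrite cE card_ord => le; exfalso.
  by move: le; rewrite -[X in (_ <= X)%N]iE ltnn.
rewrite addr0 => E; rewrite -opprB; apply: is_idealN => //.
rewrite [X in ideal_gen _ _ X]E; apply: ideal_gen_sum => c _; rewrite mulrC.
by apply: ideal_genM; apply: koszul_ideal; exact: subset_initial_n.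
Qed.

(** The vanishing of Hom(R/I', R/K), where I' is generated by m < n elements: the
    Koszul complex of these elements is zero in degree n, and so is the composite
    of [colon_lift]. *)
Lemma colon_initial m p : (m < n)%N ->
  (forall q, ideal g q -> ideal_gen [pred j : 'I_n | (j < m)%N] f q) ->
  (forall q, ideal_gen [pred j : 'I_n | (j < m)%N] f q -> ideal g (p * q)) ->
  ideal g p.
Proof.
move=> lt_mn gf pK; have le_mn := ltnW lt_mn.
have [|q /idealE|phi [phiE phi0]] := lift_chain_map (p := 1)
  (resolves_complex (koszul_seq_resolves g_regular (leqnn n)))
  (koszul_seq_resolves f_regular le_mn).
- exact: is_ideal_gen.
- by rewrite mul1r; exact: gf.
case: (posnP n) => [n0|n_gt0]; first by rewrite n0 in lt_mn.
have Bn : (setT \subset @initial n n) && (#|[set: 'I_n]| == n.-1.+1).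
  by rewrite subset_initial_n cardsT card_ord prednK /=.
have [|psi] := colon_lift le_mn phiE _ pK (exist _ setT Bn) (prednK n_gt0).
  by move=> b; have := phi0 b; rewrite mulr1.
rewrite big1 ?subr0 // => c _; have := valP c => /= /andP[sc].
move/eqP; rewrite [RHS]prednK // => /eqP.
by rewrite (negPf (initial_full lt_mn sc)).
Qed.

Variable phi : {set 'I_n} -> {set 'I_n} -> R.
Hypothesis phi_card : forall S T, #|S| != #|T| -> phi S T = 0.
Hypothesis phi0 : phi set0 set0 = 1.
Hypothesis phiE : forall S U,
  \sum_T phi S T * koszul f T U = \sum_T koszul g S T * phi T U.

Notation Delta := (phi setT setT).

Lemma phi_setTl T : T != setT -> phi setT T = 0.
Proof. by move=> ST; rewrite phi_card // eq_sym cardsT card_ord card_n. Qed.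

Lemma phi_set0l T : T != set0 -> phi set0 T = 0.
Proof. by move=> ST; rewrite phi_card // cards0 eq_sym cards_eq0. Qed.

(** Cramer's rule: it is the compatibility of phi with the differentials in the
    top degree. *)
Lemma Delta_ideal q : ideal f q -> ideal g (q * Delta).
Proof.
move=> [c ->]; rewrite big_distrl /=; apply: ideal_gen_sum => i _.
rewrite -mulrA; apply: ideal_genM.
have [b bE] := koszul_setT f i.
have := phiE setT (~: [set i]); rewrite (bigD1 setT) //=.
rewrite big1 ?addr0 => [E|T /phi_setTl->].
  have -> : f i * Delta = (-1) ^+ b * (Delta * koszul f setT (~: [set i])).
    by rewrite bE; case: b {bE} => /=; ring.
  rewrite E; apply/ideal_genM/ideal_gen_sum => T _; rewrite mulrC.
  by apply/ideal_genM/idealE/koszul_ideal/subset_initial_n.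
by rewrite mul0r.
Qed.

(** In degree n both Koszul complexes have rank one, so [colon_lift] makes p a
    multiple of Delta modulo the ideal of g. *)
Lemma colon_eq_adjoin_Delta p : (0 < n)%N ->
  colon (ideal g) (ideal f) p <-> exists c, ideal g (p - c * Delta).
Proof.
move=> n_gt0; split=> [pK|[c pc] q fq]; last first.
  rewrite -(subrK (c * Delta) p) mulrDl; apply: ideal_genD.
    by rewrite mulrC; apply: ideal_genM.
  by rewrite -mulrA; apply: ideal_genM; rewrite mulrC; exact: Delta_ideal.
pose ph i (b : gidx (koszul_seq n g) i) (c : gidx (koszul_seq n f) i) :=
  phi (val b) (val c).
have Bn : (setT \subset @initial n n) && (#|[set: 'I_n]| == n.-1.+1).
  by rewrite subset_initial_n cardsT card_ord prednK /=.
have B0 : (set0 \subset @initial n n) && (#|@set0 'I_n| == 0%N).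
  by rewrite sub0set cards0.
have phE : chain_map ph.
  move=> i b c; have /andP[_ /eqP bi] := valP b; have /andP[_ /eqP ci] := valP c.
  rewrite /fmul /ph /=.
  rewrite (@sum_sig_all _ _ _ (fun S => (S \subset initial n) && (#|S| == i.+1))
    (fun S => phi (val b) S * koszul f S (val c))); last first.
    move=> S; rewrite subset_initial_n /= => Si.
    by rewrite phi_card ?mul0r // bi eq_sym.
  rewrite phiE (@sum_sig_all _ _ _ (fun S => (S \subset initial n) && (#|S| == i))
    (fun S => koszul g (val b) S * phi S (val c))) // => S.
  rewrite subset_initial_n /= => Si.
  by rewrite koszul_card ?mul0r // bi eqSS eq_sym.
have ph0 b : ideal_gen [pred j : 'I_n | (j < n)%N] f (1 - \sum_c ph 0%N b c * 1).
  rewrite (bigD1 (exist _ set0 B0)) //= big1 ?addr0 /ph /=.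
    have /andP[_] := valP b; rewrite cards_eq0 => /eqP->.
    by rewrite phi0 mulr1 subrr; exact: ideal_gen0.
  move=> c; have /andP[_] := valP c; rewrite cards_eq0 => /eqP c0.
  by rewrite -val_eqE /= c0 eqxx.
have [q /idealE/pK //|psi] := colon_lift (leqnn n) phE ph0 (p := p) _
  (exist _ setT Bn) (prednK n_gt0).
rewrite (bigD1 (exist _ setT Bn)) //= big1 ?addr0 /ph /=.
  by move=> H; exists (psi (exist _ setT Bn)); rewrite mulrC.
move=> c; rewrite -val_eqE /= => cT; rewrite phi_setTl ?mul0r //.
Qed.

(** The dual argument: a times the transpose of phi maps the dual Koszul complex
    of f, a resolution of R/I, to that of g, a resolution of R/K. It is zero on
    R/I when a Delta lies in K, hence null-homotopic; in the last degree, where the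
    transpose of phi is the identity of R, the homotopy expresses a in terms of
    the f_i. *)
Lemma colon_Delta a : (0 < n)%N -> ideal g (a * Delta) -> ideal f a.
Proof.
move=> n_gt0 aD.
have cardn S : (#|S| <= n)%N by rewrite -[X in (_ <= X)%N]card_ord max_card.
pose al i (T : gidx (dual_koszul_seq f) i) (A : gidx (dual_koszul_seq g) i) :=
  a * phi (val A) (val T).
have sumE m (F : {set 'I_n} -> R) : (forall S, (n - #|S|)%N != m -> F S = 0) ->
    \sum_(x : {S : {set 'I_n} | (n - #|S|)%N == m}) F (val x) = \sum_S F S.
  exact: sum_sig_all.
have [||h [h0 hE]] := null_homotopic (al := al)
  (resolves_complex (dual_koszul_seq_resolves f_regular))
  (dual_koszul_seq_resolves g_regular).
- move=> i T A; have /eqP Ti := valP T; have /eqP Ai := valP A.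
  have nC (S S' : {set 'I_n}) : (n - #|S|)%N != (n - #|S'|)%N -> #|S| != #|S'|.
    by apply: contra => /eqP->.
  rewrite /fmul /al /=.
  rewrite (sumE i.+1 (fun S => a * phi S (val T) * koszul g (val A) S)).
    rewrite (sumE i (fun S => koszul f S (val T) * (a * phi (val A) S))).
      transitivity (a * \sum_S koszul g (val A) S * phi S (val T)).
        by rewrite big_distrr; apply: eq_bigr => S _ /=; ring.
      by rewrite -phiE big_distrr; apply: eq_bigr => S _ /=; ring.
    by move=> S Si; rewrite phi_card ?mulr0 // nC // Ai eq_sym.
  by move=> S Si; rewrite phi_card ?mulr0 ?mul0r // nC // Ti.
- move=> T; have BT : (n - #|[set: 'I_n]|)%N == 0%N by rewrite cardsT card_ord subnn.
  have T0 (U : gidx (dual_koszul_seq g) 0) : val U = setT.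
    have /eqP U0 := valP U; apply/eqP; rewrite -card_n eqn_leq cardn.
    by rewrite -subn_eq0 U0.
  rewrite (bigD1 (exist _ setT BT)) //= big1 ?addr0 /al /= ?mulr1.
    by rewrite (T0 T).
  by move=> U; rewrite -val_eqE /= (T0 U) eqxx.
have B0 : (n - #|@set0 'I_n|)%N == n.-1.+1 by rewrite cards0 subn0 prednK.
have := hE _ (exist _ set0 B0) (exist _ set0 B0); rewrite /al /= phi0 mulr1 => ->.
rewrite [fmul (h _) _ _ _]big1 ?addr0 => [|S _].
  apply: ideal_gen_sum => S _; rewrite mulrC; apply/ideal_genM/idealE.
  exact/koszul_ideal/subset_initial_n.
exfalso; have /eqP SE := valP S; have := leq_subr #|val S| n.
by rewrite [X in (X <= _)%N]SE prednK // ltnn.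
Qed.

End Linkage.

(** * The dual mapping cone is a resolution *)

Section Cone.

Variables (k : fieldType) (N n : nat).
Notation R := {mpoly k[N]}.
Notation X := ({set 'I_n} + {set 'I_n})%type.
Implicit Types (S T U A : {set 'I_n}).

Variables (f g : 'I_n -> R).
Hypothesis f_regular : regular_sequence f.
Hypothesis g_regular : regular_sequence g.
Hypothesis n_gt0 : (0 < n)%N.

Variable phi : {set 'I_n} -> {set 'I_n} -> R.
Hypothesis phi_card : forall S T, #|S| != #|T| -> phi S T = 0.
Hypothesis phi0 : phi set0 set0 = 1.
Hypothesis phiE : forall S U,
  \sum_T phi S T * koszul f T U = \sum_T koszul g S T * phi T U.

Let colonP p := @colon_eq_adjoin_Delta k N n f g f_regular g_regular phi
  phi_card phi0 phiE p n_gt0.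

Definition phi_dual (v : {set 'I_n} -> R) A := \sum_T v T * phi A T.

Lemma phi_dual_koszul_d v A :
  phi_dual (dual_koszul_d f v) A = dual_koszul_d g (phi_dual v) A.
Proof.
rewrite /phi_dual /dual_koszul_d; under eq_bigr => T _ do rewrite big_distrl /=.
under [RHS]eq_bigr => S _ do rewrite big_distrl /=.
rewrite exchange_big [RHS]exchange_big; apply: eq_bigr => T _ /=.
transitivity (v T * \sum_S phi A S * koszul f S T).
  by rewrite big_distrr; apply: eq_bigr => S _ /=; ring.
by rewrite phiE big_distrr; apply: eq_bigr => S _ /=; ring.
Qed.

Lemma dual_koszul_d_set0 (h : 'I_n -> R) v : dual_koszul_d h v set0 = 0.
Proof.
by rewrite /dual_koszul_d big1 // => S _; rewrite koszul_card ?mulr0 // cards0.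
Qed.

Lemma phi_dual_set0 v : phi_dual v set0 = v set0.
Proof.
rewrite /phi_dual (bigD1 set0) //= phi0 mulr1 big1 ?addr0 // => T T0.
by rewrite phi_set0l ?mulr0.
Qed.

Definition cone_good (x : X) : bool :=
  match x with inl A => A != set0 | inr T => T != set0 end.

Definition cone_deg (x : X) : nat :=
  match x with inl A => n - #|A| | inr T => n.+1 - #|T| end.

Lemma card_le_n S : (#|S| <= n)%N.
Proof. by rewrite -[X in (_ <= X)%N]card_ord max_card. Qed.

Lemma cone_basisE i x : cone_basis i x = cone_good x && (cone_deg x == i).
Proof.
case: x => A /=; congr (_ && _).
  by have := card_le_n A; move: #|A| => a le; apply/eqP/eqP => E; lia.
by have := card_le_n A; move: #|A| => a le; apply/eqP/eqP => E; lia.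
Qed.

Notation cone_d := (cone_diff f g phi).

Lemma cone_d_deg x y : cone_deg x != (cone_deg y).+1 -> cone_d x y = 0.
Proof.
have subn_card S T : #|S| = #|T|.+1 -> (n - #|T|)%N = (n - #|S|).+1.
  by move=> E; have := card_le_n S; rewrite E => lt; rewrite subnS prednK ?subn_gt0.
case: x => S; case: y => T //= ne.
- by rewrite koszul_card //; apply: contra ne => /eqP /subn_card->.
- rewrite phi_card //; apply: contra ne => /eqP->.
  by rewrite subSn ?card_le_n.
rewrite koszul_card ?oppr0 //; apply: contra ne => /eqP E.
by rewrite !subSn ?card_le_n // (subn_card _ _ E).
Qed.

Lemma sum_cone (v : X -> R) y :
  \sum_x v x * cone_d x y
  = match y with
    | inl A => dual_koszul_d g (v \o inl) A + phi_dual (v \o inr) A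
    | inr T => - dual_koszul_d f (v \o inr) T
    end.
Proof.
rewrite big_sumType /=; case: y => A //=.
rewrite big1 ?add0r => [|S _]; last by rewrite mulr0.
by rewrite -sumrN; apply: eq_bigr => S _; rewrite mulrN.
Qed.

Lemma cone_dd x z : cone_good x -> cone_good z ->
  \sum_(y | cone_good y) cone_d x y * cone_d y z = 0.
Proof.
move=> Gx Gz.
have -> : \sum_(y | cone_good y) cone_d x y * cone_d y z
        = \sum_y cone_d x y * cone_d y z.
  rewrite [RHS](bigID cone_good) /= [X in _ = _ + X]big1 ?addr0 // => -[] A /=;
    rewrite negbK => /eqP -> {A}.
    case: x Gx => T T0 /=; first by rewrite koszul_card ?mul0r // cards0.
    by rewrite phi_set0l ?mul0r.
  case: x Gx => T T0 /=; first by rewrite mul0r.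
  by rewrite koszul_card ?oppr0 ?mul0r // cards0.
rewrite sum_cone; case: z Gz => [A _|T _]; case: x Gx => S _ /=.
- rewrite /phi_dual [X in _ + X]big1 ?addr0 => [|T _]; last by rewrite mul0r.
  by rewrite -[RHS](koszul_koszul g A S); apply: eq_bigr => T _; rewrite mulrC.
- rewrite /dual_koszul_d /phi_dual.
  rewrite (eq_bigr (fun T => koszul g A T * phi T S)); last first.
    by move=> T _; rewrite mulrC.
  rewrite -phiE -big_split big1 //= => T _; ring.
- by rewrite /dual_koszul_d big1 ?oppr0 // => U _; rewrite mul0r.
apply/eqP; rewrite oppr_eq0; apply/eqP.
transitivity (- \sum_U koszul f T U * koszul f U S).
  by rewrite -sumrN; apply: eq_bigr => U _ /=; ring.
by rewrite koszul_koszul oppr0.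
Qed.

(** The mapping cone of a map of resolutions is exact in positive degrees when the
    map of resolved modules, here Delta : R/I -> R/K, is injective. The last step
    deals with the cancelled pair of basis elements. *)
Lemma cone_exact (u : X -> R) : (forall x, ~~ cone_good x -> u x = 0) ->
  colon (ideal g) (ideal f) (u (inl setT)) ->
  (forall y, cone_good y -> \sum_x u x * cone_d x y = 0) ->
  exists w : X -> R, (forall x, ~~ cone_good x -> w x = 0) /\
    forall y, cone_good y -> u y = \sum_x w x * cone_d x y.
Proof.
move=> su uT du.
have uL0 : u (inl set0) = 0 by apply: su; rewrite /= eqxx.
have uR0 : u (inr set0) = 0 by apply: su; rewrite /= eqxx.
pose uL := u \o inl; pose uR := u \o inr.
have duL A : dual_koszul_d g uL A + phi_dual uR A = 0.
  case: (eqVneq A set0) => [->|A0].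
    by rewrite dual_koszul_d_set0 phi_dual_set0 add0r.
  by have := du (inl A) A0; rewrite sum_cone.
have duR T : dual_koszul_d f uR T = 0.
  case: (eqVneq T set0) => [->|T0]; first by rewrite dual_koszul_d_set0.
  by have := du (inr T) T0; rewrite sum_cone => /eqP; rewrite oppr_eq0 => /eqP.
(* the last component of [uR] is killed by [Delta] modulo the ideal of [g] *)
have uRT : ideal f (uR setT).
  apply: (colon_Delta f_regular g_regular phi_card phi0 phiE) => //.
  have := duL setT; rewrite {1}/phi_dual (bigD1 setT) //= big1 ?addr0 => [|T nT].
    rewrite addrC => /eqP; rewrite addr_eq0 => /eqP->; apply: ideal_genN.
    apply: ideal_gen_sum => S _; apply/ideal_genM/idealE/koszul_ideal.
    exact: subset_initial_n.
  by rewrite phi_setTl ?mulr0.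
have [w1 uRE] := dual_koszul_acyclic f_regular uRT duR.
have [c uTc] := (colonP _).1 uT.
pose wR T := - (w1 T) + single setT (c + w1 setT) T.
have dsingle a : dual_koszul_d f (single setT a) =1 fun=> 0.
  move=> T; rewrite /dual_koszul_d (bigD1 setT) //= /single eqxx.
  rewrite big1 ?addr0 => [|S /negPf->].
    by rewrite koszul_card ?mulr0 // cardsT card_ord neq_ltn ltnS card_le_n.
  by rewrite mul0r.
have dwR T : dual_koszul_d f wR T = - uR T.
  rewrite uRE -[RHS]addr0 -(dsingle (c + w1 setT) T) -sumrN -big_split /=.
  by apply: eq_bigr => S _; rewrite /wR; ring.
have wRT : wR setT = c by rewrite /wR /single eqxx; ring.
pose v A := uL A - phi_dual wR A.
have [||wL vE] := dual_koszul_acyclic (v := v) g_regular.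
- rewrite /v {1}/phi_dual (bigD1 setT) //= big1 ?addr0 ?wRT // => T nT.
  by rewrite phi_setTl ?mulr0.
- move=> A; transitivity (dual_koszul_d g uL A - dual_koszul_d g (phi_dual wR) A).
    by rewrite /dual_koszul_d -sumrB; apply: eq_bigr => S _; rewrite mulrBl.
  rewrite -phi_dual_koszul_d -(duL A); congr (_ + _).
  by rewrite /phi_dual -sumrN; apply: eq_bigr => S _; rewrite dwR; ring.
have wR0 : wR set0 = 0.
  have := vE set0; rewrite dual_koszul_d_set0 /v phi_dual_set0 /uL /= uL0 sub0r.
  by move/eqP; rewrite oppr_eq0 => /eqP.
(* [wL] may have a component on the empty set; it is removed by subtracting the
   boundary of a multiple of [inr set0] *)
pose c0 := wL set0.
pose r : {set 'I_n} -> R := single set0 c0.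
pose wL' A := wL A - phi_dual r A.
pose wR' T := wR T + dual_koszul_d f r T.
have r0 : phi_dual r set0 = c0 by rewrite phi_dual_set0 /r /single eqxx.
pose w (x : X) := match x with inl A => wL' A | inr T => wR' T end.
exists w; split=> [[A|T]|y Gy].
- rewrite negbK => /eqP->; by rewrite /= /wL' r0 subrr.
- by rewrite negbK => /eqP->; rewrite /= /wR' wR0 dual_koszul_d_set0 addr0.
rewrite sum_cone; case: y Gy => A _.
  rewrite -[u _]/(uL A) -[uL A](subrK (phi_dual wR A)) -/(v A) vE.
  transitivity (dual_koszul_d g wL A - dual_koszul_d g (phi_dual r) A
                + (phi_dual wR A + phi_dual (dual_koszul_d f r) A)).
    by rewrite phi_dual_koszul_d; ring.
  congr (_ + _).
    by rewrite /dual_koszul_d -sumrB; apply: eq_bigr => S _; rewrite -mulrBl.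
  by rewrite /phi_dual -big_split; apply: eq_bigr => S _ /=; rewrite -mulrDl.
transitivity (- (dual_koszul_d f wR A + dual_koszul_d f (dual_koszul_d f r) A)).
  by rewrite dual_koszul_dd addr0 dwR opprK.
congr (- _).
by rewrite /dual_koszul_d -big_split; apply: eq_bigr => S _ /=; rewrite -mulrDl.
Qed.

Lemma is_ideal_colon (K I : R -> Prop) : is_ideal K -> is_ideal (colon K I).
Proof.
move=> [K0 KD KM]; split=> [q _|p q pK qK r Ir|p q pK r Ir].
- by rewrite mul0r.
- by rewrite mulrDl; apply: KD; [exact: pK|exact: qK].
by rewrite -mulrA; apply/KM/pK.
Qed.

Lemma cone_resolves (d : 'I_n -> nat) (e : nat) :
  resolves (dual_mapping_cone f g d e phi) (fun=> 1)
           (colon (ideal g) (ideal f)).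
Proof.
apply: (@graded_seq_resolves _ _ _ _ (cone_shift d e) cone_d cone_good cone_deg
         (inl setT)).
- exact: cone_basisE.
- exact: cone_d_deg.
- case=> A /=.
    apply/andP/eqP => [[_]|[->]]; last first.
      by rewrite cardsT card_ord subnn -cards_eq0 cardsT card_ord -lt0n n_gt0.
    rewrite subn_eq0 => le; congr inl; apply/eqP; rewrite -card_n.
    by rewrite eqn_leq card_le_n.
  by rewrite subn_eq0 ltnNge card_le_n /= andbF.
- exact: cone_dd.
- exact/is_ideal_colon/is_ideal_gen.
- case=> A _ /=; apply/colonP.
    exists 0; rewrite mul0r subr0; apply/idealE/koszul_ideal.
    exact: subset_initial_n.
  case: (eqVneq A setT) => [->|nA].
    by exists 1; rewrite mul1r subrr; exact: ideal_gen0.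
  by exists 0; rewrite phi_setTl // mul0r subrr; exact: ideal_gen0.
exact: cone_exact.
Qed.

End Cone.

(** * Homogeneous parts, and shifts of minimal resolutions *)

Section HomogeneousParts.

Variables (k : fieldType) (N : nat).
Notation R := {mpoly k[N]}.
Implicit Types (p q : R) (a b z : int).

(** Shifts may be negative, whence components indexed by integers. *)
Definition hpart z p : R := if z is Posz m then pihomog mdeg m p else 0.

Lemma hpart_id z p : homog_int z p -> hpart z p = p.
Proof. by case: z => m /= => [/pihomog_dE|->]. Qed.

Lemma hpart_homog z p : homog_int z (hpart z p).
Proof. by case: z => m //=; exact: pihomogP. Qed.

Lemma hpart_sum z (A : finType) (P : pred A) (h : A -> R) :
  hpart z (\sum_(x | P x) h x) = \sum_(x | P x) hpart z (h x).
Proof. by case: z => m /=; rewrite ?raddf_sum // big1. Qed.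

Lemma hpartB z p q : hpart z (p - q) = hpart z p - hpart z q.
Proof. by case: z => m /=; rewrite ?raddfB // subrr. Qed.

Lemma hpartM a b p q : homog_int b q -> hpart (a + b) (p * q) = hpart a p * q.
Proof.
case: b => [b|b] /= hq; last first.
  by rewrite hq !mulr0; case: (_ + _) => //= m; rewrite raddf0.
rewrite {1}(pihomog_partitionE (leqnn (mmeasure mdeg p))) big_distrl /= hpart_sum.
have E (i : nat) : hpart (a + b) (pihomog mdeg i p * q)
    = if a == i then pihomog mdeg i p * q else 0.
  have hi : pihomog mdeg i p * q \is (i + b).-homog.
    by apply: dhomogM => //; exact: pihomogP.
  case: eqP => [->|ai]; first by rewrite /= pihomog_dE.
  case E : (a + b) => [m|m] //=; rewrite (pihomog_ne0 _ hi) //.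
  by apply/eqP => im; apply: ai; lia.
under eq_bigr => i _ do rewrite E.
rewrite -big_mkcond /=.
case: a {E} => [a|a] /=; last by rewrite big_pred0 ?mul0r.
case: (ltnP a (mmeasure mdeg p)) => [lt|le].
  by rewrite (big_pred1 (Ordinal lt)) // => i /=; rewrite eq_sym.
rewrite big_pred0 => [|i].
  rewrite pihomogE big_seq_cond big1 ?mul0r // => m.
  move=> /andP[/mmeasure_mnm_lt lt /eqP ma].
  by have := leq_trans (lt _) le; rewrite ma ltnn.
by apply/negP => /eqP[ai]; have := ltn_ord i; rewrite -ai ltnNge le.
Qed.

Lemma homog_int_coeff0 z p : homog_int z p -> p@_0%MM != 0 -> z = 0.
Proof.
case: z => m /= => [hp|->]; last by rewrite mcoeff0 eqxx.
case: (eqVneq m 0%N) => [->//|m0].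
by rewrite (dhomog_nemf_coeff hp) ?eqxx //= mdeg0 eq_sym.
Qed.

Lemma ideal_gen_hpart n (P : pred 'I_n) (f : 'I_n -> R) (d : 'I_n -> nat) :
  (forall i, f i \is (d i).-homog) ->
  forall z p, ideal_gen P f p -> ideal_gen P f (hpart z p).
Proof.
move=> fd z p [c ->]; exists (fun j => hpart (z - (d j)%:Z) (c j)).
rewrite hpart_sum; apply: eq_bigr => j _.
by rewrite -{1}(subrK (d j)%:Z z) hpartM //=.
Qed.

Lemma colon_hpart n (f g : 'I_n -> R) (d e : 'I_n -> nat) :
  (forall i, f i \is (d i).-homog) -> (forall i, g i \is (e i).-homog) ->
  forall z p, colon (ideal g) (ideal f) p -> colon (ideal g) (ideal f) (hpart z p).
Proof.
move=> fd ge z p pK q [c ->]; rewrite big_distrr /=; apply: ideal_gen_sum => j _.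
rewrite mulrCA; apply: ideal_genM.
have -> : hpart z p * f j = hpart (z + (d j)%:Z) (p * f j) by rewrite hpartM //=.
by apply: (ideal_gen_hpart ge); apply: pK; exact: ideal_gen_in.
Qed.

End HomogeneousParts.

Section Shifts.

Variables (k : fieldType) (N : nat).
Notation R := {mpoly k[N]}.
Variables (J : R -> Prop) (P F : gfree_seq k N).
Variables (aP : gidx P 0 -> R) (aF : gidx F 0 -> R).

Hypothesis J_ideal : is_ideal J.
Hypothesis J_homog : forall z p, J p -> J (hpart z p).
Hypothesis P_resolves : resolves P aP J.
Hypothesis F_resolves : resolves F aF J.
Hypothesis P_homog : forall i (b : gidx P i.+1) (c : gidx P i),
  homog_int (gshift b - gshift c) (gdiff b c).
Hypothesis F_homog : forall i (b : gidx F i.+1) (c : gidx F i),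
  homog_int (gshift b - gshift c) (gdiff b c).
Hypothesis aP_homog : forall b, homog_int (gshift b) (aP b).
Hypothesis aF_homog : forall b, homog_int (gshift b) (aF b).
Hypothesis P_minimal : minimal P.

(** Taking in each entry the component of the right degree preserves
    compatibility with the differentials, because these are homogeneous. *)
Lemma homogeneous_lift : exists al : forall i, gidx P i -> gidx F i -> R,
  [/\ chain_map al, forall b, J (aP b - \sum_c al 0%N b c * aF c)
    & forall i b c, homog_int (gshift b - gshift c) (al i b c)].
Proof.
have [q|al [alE al0]] := lift_chain_map (p := 1) (resolves_complex P_resolves)
  F_resolves J_ideal; first by rewrite mul1r.
exists (fun i b c => hpart (gshift b - gshift c) (al i b c)); split.
- move=> i b c; have := congr1 (hpart (gshift b - gshift c)) (alE i b c).
  rewrite /fmul !hpart_sum => E; transitivity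
    (\sum_x hpart (gshift b - gshift c) (al i.+1 b x * gdiff x c)).
    apply: eq_bigr => x _; rewrite -(hpartM _ _ (F_homog x c)).
    by congr hpart; rewrite addrA subrK.
  rewrite E; apply: eq_bigr => x _; rewrite mulrC [RHS]mulrC.
  rewrite -(hpartM _ _ (P_homog b x)); congr hpart.
  by ring.
- move=> b; have := J_homog (gshift b) (al0 b); rewrite mul1r hpartB hpart_id //.
  rewrite hpart_sum; congr (J (_ - _)); apply: eq_bigr => c _.
  by rewrite -(hpartM _ _ (aF_homog c)) subrK.
by move=> i b c; exact: hpart_homog.
Qed.

(** In the constant terms of P -> F -> P = id + dh + hd the homotopy disappears by
    minimality of P. The basis element b therefore has an entry with nonzero
    constant term in the row of P -> F; as this entry is homogeneous, its degree
    is 0. *)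
Lemma minimal_shift i (b : gidx P i.+1) :
  exists c : gidx F i.+1, gshift c = gshift b.
Proof.
have [al [alE al0 alh]] := homogeneous_lift.
have [q|be [h [_ hE]]] := round_trip_null_homotopic (p := 1) P_resolves J_ideal
  (resolves_complex F_resolves) _ alE al0; first by rewrite mul1r.
have := congr1 (mcoeff 0%MM) (hE i b b).
rewrite mcoeffB mcoeffD /fscalar eqxx mulr1 mcoeff1 eqxx /fmul !raddf_sum /=.
rewrite [X in _ = X + _]big1 => [|x _]; last first.
  by rewrite rmorphM /= P_minimal mul0r.
rewrite [X in _ = _ + X]big1 ?addr0 => [|x _]; last first.
  by rewrite rmorphM /= P_minimal mulr0.
move/eqP; rewrite subr_eq0 => /eqP E.
have [[c ac]|al00] := altP (@existsP _ (fun c => (al i.+1 b c)@_0%MM != 0)).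
  exists c; move/(homog_int_coeff0 (alh _ _ _))/eqP: ac.
  by rewrite subr_eq0 => /eqP.
move: E; rewrite big1 => [/esym/eqP|c _]; first by rewrite oner_eq0.
rewrite rmorphM /=; move: al00; rewrite negb_exists => /forallP/(_ c).
by rewrite negbK => /eqP->; rewrite mul0r.
Qed.

End Shifts.

(** * Hilbert functions *)

Section HilbertFunction.

Variables (k : fieldType) (N : nat).
Notation R := {mpoly k[N]}.
Implicit Types (J K I : R -> Prop).

Lemma is_idealB J p q : is_ideal J -> J p -> J q -> J (p - q).
Proof.
by move=> idJ Jp Jq; have [_ JD _] := idJ; apply: JD => //; exact: is_idealN.
Qed.

Lemma is_idealZ J (c : k) p : is_ideal J -> J p -> J (c *: p).
Proof. by move=> [_ _ JM] Jp; rewrite -mul_mpolyC; exact: JM. Qed.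

Definition lincomb h (b : 'I_h -> R) (c : 'rV[k]_h) : R := \sum_i c 0 i *: b i.

Lemma lincombB h (b : 'I_h -> R) c c' :
  lincomb b (c - c') = lincomb b c - lincomb b c'.
Proof. by rewrite -sumrB; apply: eq_bigr => i _; rewrite !mxE scalerBl. Qed.

Lemma lincomb0 h (b : 'I_h -> R) : lincomb b 0 = 0.
Proof. by rewrite /lincomb big1 // => i _; rewrite mxE scale0r. Qed.

Lemma lincomb_homog t h (b : 'I_h -> R) c :
  (forall i, b i \is t.-homog) -> lincomb b c \is t.-homog.
Proof. by move=> bt; apply: rpred_sum => i _; apply: rpredZ. Qed.

(** Spanning and independence are easier to handle separately than as the unique
    existence of coordinates. *)
Lemma hilbert_valueP J t h : is_ideal J ->
  hilbert_value J t h <-> exists b : 'I_h -> R,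
    [/\ forall i, b i \is t.-homog,
        forall p, p \is t.-homog -> exists c, J (p - lincomb b c)
      & forall c, J (lincomb b c) -> c = 0].
Proof.
move=> idJ; have [J0 JD JM] := idJ.
split=> [[b [bt bP]]|[b [bt bS bI]]]; exists b; split=> //.
- by move=> p /bP [c [Jc _]]; exists c.
- move=> c Jc; have [c' [_ u]] := bP _ (lincomb_homog c bt).
  by rewrite -(u c) ?subrr // -(u 0) // -[X in _ - X]/(lincomb b 0) lincomb0 subr0.
move=> p /bS [c Jc]; exists c; split=> // c' Jc'; apply/eqP.
rewrite -subr_eq0; apply/eqP/bI; rewrite lincombB.
have := is_idealB idJ Jc' Jc; congr J; rewrite -/(lincomb b c'); ring.
Qed.

Lemma hilbert_value_le J t h h' : is_ideal J ->
  hilbert_value J t h -> hilbert_value J t h' -> (h <= h')%N.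
Proof.
move=> idJ /(hilbert_valueP _ _ idJ)[b [bt bS bI]].
move=> /(hilbert_valueP _ _ idJ)[b' [b't b'S _]].
have [A AE] := row_choice (fun i => b'S _ (bt i)).
have [B BE] := row_choice (fun j => bS _ (b't j)).
have lc (i : 'I_h) : lincomb b (row i (1%:M)) = b i.
  rewrite /lincomb (bigD1 i) //= !mxE eqxx scale1r big1 ?addr0 // => j ji.
  by rewrite !mxE eq_sym (negPf ji) scale0r.
apply: (@mulmx1_min _ _ _ (\matrix_i A i) (\matrix_j B j)).
apply/row_matrixP => i; apply/eqP; rewrite -subr_eq0; apply/eqP/bI.
rewrite lincombB lc -opprB; apply: is_idealN => //.
have -> : b i - lincomb b (row i (\matrix_i A i *m \matrix_j B j))
  = (b i - lincomb b' (A i)) + \sum_j A i 0 j *: (b' j - lincomb b (B j)).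
  under eq_bigr => j _ do rewrite scalerBr.
  rewrite sumrB -/(lincomb b' (A i)) addrA subrK; congr (_ - _).
  rewrite /lincomb; under [RHS]eq_bigr => j _ do rewrite scaler_sumr.
  rewrite exchange_big; apply: eq_bigr => l _ /=.
  rewrite !mxE scaler_suml; apply: eq_bigr => j _.
  by rewrite scalerA !mxE.
have [J0 JD _] := idJ; apply: (JD); first exact: AE.
apply: (big_ind J) => [||j _]; [exact: J0|exact: JD|].
by apply: is_idealZ => //; exact: BE.
Qed.

Lemma hilbert_value_unique J t h h' : is_ideal J ->
  hilbert_value J t h -> hilbert_value J t h' -> h = h'.
Proof.
move=> idJ hv hv'; apply/eqP; rewrite eqn_leq.
by rewrite (hilbert_value_le idJ hv hv') (hilbert_value_le idJ hv' hv).
Qed.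

(** Additivity along 0 -> (R/I)(-dl) -> R/K -> R/J -> 0, where the first map is
    multiplication by q: a basis of R/J and q times a basis of R/I form a basis of
    R/K. *)
Lemma hilbert_value_add K J I (q : R) (dl t h1 h2 : nat) :
  is_ideal K -> is_ideal J -> is_ideal I ->
  (forall z p, K p -> K (hpart z p)) -> q \is dl.-homog ->
  (forall p, J p <-> exists c, K (p - c * q)) ->
  (forall a, K (a * q) <-> I a) ->
  hilbert_value I t h1 -> hilbert_value J (t + dl) h2 ->
  hilbert_value K (t + dl) (h2 + h1).
Proof.
move=> idK idJ idI Kh qd JE IE.
move=> /(hilbert_valueP _ _ idI)[b1 [b1t b1S b1I]].
move=> /(hilbert_valueP _ _ idJ)[b2 [b2t b2S b2I]].
apply/hilbert_valueP => //.
pose b i := match split i with inl i2 => b2 i2 | inr i1 => b1 i1 * q end.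
have bE c : lincomb b c = lincomb b2 (lsubmx c) + lincomb b1 (rsubmx c) * q.
  rewrite /lincomb big_split_ord /= big_distrl /=; congr (_ + _).
    by apply: eq_bigr => i _; rewrite mxE /b (unsplitK (inl _ i)).
  by apply: eq_bigr => i _; rewrite mxE /b (unsplitK (inr _ i)) /= -scalerAl.
have [K0 KD KM] := idK.
exists b; split.
- move=> i; rewrite /b; case: (split i) => j //; exact: dhomogM.
- move=> p pt; have [c2 Jc2] := b2S p pt.
  have [c Kc] := (JE _).1 Jc2.
  have [c1 Ic1] := b1S _ (pihomogP mdeg t c).
  exists (row_mx c2 c1); rewrite bE row_mxKl row_mxKr.
  have := Kh (t + dl)%N%:Z _ Kc.
  rewrite hpartB (hpart_id (z := (t + dl)%N%:Z)) /=; last first.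
    by apply: rpredB => //; exact: lincomb_homog.
  rewrite -[pihomog _ _ (c * q)]/(hpart (t%:Z + dl%:Z) (c * q)) hpartM //=.
  have := (IE _).2 Ic1; move=> H1 H2.
  have := KD _ _ H2 H1; congr K; ring.
move=> c; rewrite bE => Kc.
have c2 : lsubmx c = 0.
  apply: b2I; apply/JE; exists (- lincomb b1 (rsubmx c)).
  by rewrite mulNr opprK.
have c1 : rsubmx c = 0.
  by apply/b1I/IE; move: Kc; rewrite c2 lincomb0 add0r.
by rewrite -(hsubmxK c) c1 c2 row_mx0.
Qed.

(** Multiples of q vanish below its degree, so that R/J and R/K agree there. *)
Lemma hilbert_value_low K J (q : R) (dl t h : nat) :
  is_ideal K -> is_ideal J ->
  (forall z p, K p -> K (hpart z p)) -> q \is dl.-homog ->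
  (forall p, J p <-> exists c, K (p - c * q)) -> (t < dl)%N ->
  hilbert_value J t h -> hilbert_value K t h.
Proof.
move=> idK idJ Kh qd JE lt /(hilbert_valueP _ _ idJ)[b [bt bS bI]].
apply/hilbert_valueP => //; exists b; split=> //.
  move=> p pt; have [c Jc] := bS p pt; exists c.
  have [c' Kc] := (JE _).1 Jc; have := Kh t%:Z _ Kc.
  rewrite hpartB hpart_id /=; last by apply: rpredB => //; exact: lincomb_homog.
  rewrite -[pihomog _ _ (c' * q)]/(hpart t%:Z (c' * q)).
  rewrite -(subrK dl%:Z t%:Z) hpartM //.
  suff -> : hpart (t%:Z - dl%:Z) c' = 0 by rewrite mul0r subr0.
  by case E : (t%:Z - dl%:Z) => [m|m] //; lia.
move=> c Kc; apply: bI; apply/JE; exists 0; by rewrite mul0r subr0.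
Qed.

End HilbertFunction.

Section HilbertExistence.

Variables (k : fieldType).

(** A vector subspace given by an arbitrary predicate is exhausted by a subspace
    of maximal dimension inside it. *)
Lemma vspace_of_pred (V : vectType k) (W : V -> Prop) :
  W 0 -> (forall c u v, W u -> W v -> W (c *: u + v)) ->
  exists U : {vspace V}, forall v, v \in U <-> W v.
Proof.
move=> W0 WD; apply: NNPP => nex.
have big m : exists U : {vspace V}, (forall v, v \in U -> W v) /\ (m <= \dim U)%N.
  elim: m => [|m [U [UW dU]]]; first by exists 0%VS; split=> // v /vlineP[c ->];
    rewrite scaler0.
  have [w [Ww nw]] : exists w, W w /\ w \notin U.
    apply: NNPP => nw; apply: nex; exists U => v; split=> [/UW//|Wv].
    by apply: contra_notT nw => nv; exists v.
  exists (<[w]> + U)%VS; split=> [v /memv_addP[u /vlineP[c ->] [u' /UW Wu' ->]]|].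
    exact: WD.
  apply: (leq_ltn_trans dU); rewrite ltn_neqAle dimvS ?addvSr // andbT.
  apply: contra nw => /eqP E.
  have /eqP-> : U == (<[w]> + U)%VS by rewrite eqEdim addvSr E /=.
  by rewrite memvE addvSl.
have [U [_]] := big (\dim {:V}).+1.
by rewrite ltnNge dimvS ?subvf.
Qed.

Variable N : nat.
Notation R := {mpoly k[N.+1]}.

Lemma hilbert_value_dim (J : R -> Prop) t : is_ideal J ->
  exists U : {vspace dhomog N.+1 k t},
    (forall v : dhomog N.+1 k t, v \in U <-> J (mpoly_of_dhomog v)) /\
    hilbert_value J t ('C(t + N, t) - \dim U)%N.
Proof.
move=> idJ; have [J0 JD JM] := idJ.
have [||U UE] := @vspace_of_pred (dhomog N.+1 k t) (fun v => J (mpoly_of_dhomog v)).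
- by rewrite raddf0.
- move=> c u v Ju Jv; rewrite raddfD /= ; apply: JD => //.
  exact: (is_idealZ c idJ Ju).
exists U; split=> //.
have -> : ('C(t + N, t) - \dim U)%N = \dim (U^C).
  by rewrite dimv_compl dimvf.
apply/hilbert_valueP => //.
pose b (i : 'I_(\dim U^C))   : R := mpoly_of_dhomog (vbasis U^C)`_i.
have bE c : lincomb b c = mpoly_of_dhomog (\sum_i c 0 i *: (vbasis U^C)`_i).
  by rewrite raddf_sum; apply: eq_bigr.
exists b; split.
- by move=> i; exact: dhomog_is_dhomog.
- move=> p pt; pose v : dhomog N.+1 k t := DHomog pt.
  have : v \in (U + U^C)%VS by rewrite addv_complf memvf.
  move=> /memv_addP[u uU [w /coord_vbasis wE vE]].
  exists (\row_i coord (vbasis U^C) i w).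
  rewrite bE.
  have -> : \sum_i (\row_i coord (vbasis U^C) i w) 0 i *: (vbasis U^C)`_i = w.
    by rewrite [RHS]wE; apply: eq_bigr => i _; rewrite mxE.
  by rewrite -[p]/(mpoly_of_dhomog v) vE raddfD /= addrK; apply/UE.
move=> c; rewrite bE => /UE cU.
have cC : \sum_i c 0 i *: (vbasis U^C)`_i \in (U^C)%VS.
  by apply: rpred_sum => i _; apply/rpredZ/vbasis_mem/mem_nth; rewrite size_tuple.
have : \sum_i c 0 i *: (vbasis U^C)`_i = 0.
  by apply/eqP; rewrite -memv0 -(capv_compl U) memv_cap cU cC.
move/freeP: (basis_free (vbasisP (U^C))) => /(_ (fun i => c 0 i)) H /H c0.
by apply/rowP => i; rewrite mxE c0.
Qed.

Lemma hilbert_value_exists (J : R -> Prop) t : is_ideal J ->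
  exists h, hilbert_value J t h.
Proof. by move=> /hilbert_value_dim => /(_ t)[U [_ hv]]; eexists; exact: hv. Qed.

Lemma hilbert_value0 t (J : R -> Prop) : is_ideal J -> (forall p, J p -> p = 0) ->
  hilbert_value J t 'C(t + N, t).
Proof.
move=> idJ J0; have [U [UE]] := hilbert_value_dim t idJ.
suff -> : U = 0%VS by rewrite dimv0 subn0.
apply/vspaceP => v; rewrite memv0; apply/idP/eqP => [/UE/J0 v0|->].
  by apply: val_inj; rewrite [LHS]v0 [RHS]raddf0.
exact: mem0v.
Qed.

End HilbertExistence.

(** * Hilbert series and multiplicity *)

(** The coefficient of z^t in the product of A and the power series with
    coefficients H. *)
Definition conv (A : {poly rat}) (H : nat -> rat) t : rat :=
  \sum_(j < t.+1) A`_j * H (t - j)%N.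

Lemma convE A H T t : (t < T)%N -> conv A H t = (A * \poly_(i < T) H i)`_t.
Proof.
move=> lt; rewrite coefM; apply: eq_bigr => j _; rewrite coef_poly.
by rewrite (leq_ltn_trans (leq_subr j t) lt).
Qed.

Lemma eq_conv A H H' : H =1 H' -> conv A H =1 conv A H'.
Proof. by move=> HH t; apply: eq_bigr => j _; rewrite HH. Qed.

Lemma convM A C H t : conv (A * C) H t = conv A (conv C H) t.
Proof.
rewrite (convE _ _ (ltnSn t)) -mulrA coefM; apply: eq_bigr => j _.
by rewrite -(convE C) // ltnS leq_subr.
Qed.

Lemma convB A C H t : conv (A - C) H t = conv A H t - conv C H t.
Proof. by rewrite -sumrB; apply: eq_bigr => j _; rewrite coefB mulrBl. Qed.

Lemma conv1 H t : conv 1 H t = H t.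
Proof.
rewrite /conv big_ord_recl coef1 mul1r subn0 big1 ?addr0 // => j _.
by rewrite coef1 mul0r.
Qed.

Lemma conv_Xn d H t : conv 'X^d H t = if (d <= t)%N then H (t - d)%N else 0.
Proof.
rewrite /conv; case: leqP => [le|lt]; last first.
  by rewrite big1 // => j _; rewrite coefXn ltn_eqF ?mul0r // (leq_trans (ltn_ord j)).
have lt : (d < t.+1)%N by [].
rewrite (bigD1 (Ordinal lt)) //= coefXn eqxx mul1r big1 ?addr0 // => j jd.
by rewrite coefXn -[d]/(val (Ordinal lt)) (inj_eq val_inj) (negPf jd) mul0r.
Qed.

(** The coefficients of 1 / (1 - z)^m. *)
Definition inv_coef m t : rat :=
  if m is m'.+1 then 'C(t + m', m')%:R else (t == 0%N)%:R.

Lemma conv_delta A t : conv A (inv_coef 0) t = A`_t.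
Proof.
rewrite /conv big_ord_recr /= subnn mulr1 big1 ?add0r // => j _.
by rewrite /inv_coef subn_eq0 leqNgt ltn_ord mulr0.
Qed.

Lemma conv_inv_coefS m t : conv (1 - 'X) (inv_coef m.+1) t = inv_coef m t.
Proof.
rewrite convB conv1 -['X]expr1 conv_Xn; case: t => [|t] /=.
  by rewrite subr0 add0n; case: m => [|m]; rewrite /= ?bin0 // !binn.
rewrite subn1 /=; case: m => [|m] /=; first by rewrite !bin0 subrr.
by rewrite [in X in X - _]addSn binS natrD addrAC subrr add0r addnS addSn.
Qed.

Lemma conv_inv_coefX j m t :
  conv ((1 - 'X) ^+ j) (inv_coef (j + m)) t = inv_coef m t.
Proof.
elim: j t => [|j IHj] t; first by rewrite expr0 conv1.
by rewrite exprSr convM (eq_conv _ (conv_inv_coefS _)) IHj.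
Qed.

Lemma poly_eventually0 (P : {poly rat}) T :
  (forall t, (T <= t)%N -> P.[t%:R] = 0) -> P = 0.
Proof.
move=> P0; apply/eqP/negP => /negP nP.
have := max_poly_roots (rs := [seq i%:R | i <- iota T (size P)]) nP.
rewrite size_map size_iota ltnn; move=> H; suff : false by [].
apply: H.
  by apply/allP => x /mapP[i]; rewrite mem_iota => /andP[le _] ->; rewrite /root P0.
by rewrite map_inj_uniq ?iota_uniq //; exact: mulrIn.
Qed.

Section HilbertPolynomial.

Variable m : nat.

(** For natural numbers t >= j its value at t is m! times the number of
    m-element subsets of a set of size t - j + m. *)
Definition bin_poly j : {poly rat} :=
  \prod_(i < m) ('X - (j%:R - (m - i)%N%:R)%:P).

Lemma bin_polyP j t : (j <= t)%N ->
  (bin_poly j).[t%:R] = m`!%:R * 'C(t - j + m, m)%:R.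
Proof.
move=> le; rewrite -natrM mulnC bin_ffact ffact_prod natr_prod horner_prod.
apply: eq_bigr => i _; rewrite hornerXsubC -addnBA; last exact: ltnW.
by rewrite natrD (natrB _ le); ring.
Qed.

Lemma bin_poly_monic j : bin_poly j \is monic.
Proof. exact: monic_prod_XsubC. Qed.

Lemma size_bin_poly j : size (bin_poly j) = m.+1.
Proof. by rewrite size_prod_XsubC /index_enum -enumT size_enum_ord. Qed.

Definition hilbert_poly (A : {poly rat}) : {poly rat} :=
  \sum_(j < size A) (A`_j / m`!%:R) *: bin_poly j.

Lemma fact_neq0 : m`!%:R != 0 :> rat.
Proof. by rewrite pnatr_eq0 -lt0n fact_gt0. Qed.

Lemma hilbert_polyP (A : {poly rat}) t : (size A <= t)%N ->
  conv A (inv_coef m.+1) t = (hilbert_poly A).[t%:R].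
Proof.
move=> le; rewrite /hilbert_poly horner_sum /conv /=.
rewrite [RHS](eq_bigr (fun j : 'I__ => A`_j * 'C(t - j + m, m)%:R)); last first.
  move=> j _; rewrite hornerZ bin_polyP; last exact: ltnW (leq_trans (ltn_ord j) le).
  by rewrite mulrA divfK ?fact_neq0.
rewrite [RHS](big_ord_widen t.+1 (fun j => A`_j * 'C(t - j + m, m)%:R)) ?leqW //.
rewrite [RHS]big_mkcond /=; apply: eq_bigr => j _.
by case: ltnP => // le'; rewrite nth_default ?mul0r.
Qed.

Lemma size_hilbert_poly A : (size (hilbert_poly A) <= m.+1)%N.
Proof.
apply: (leq_trans (size_sum _ _ _)); apply/bigmax_leqP => j _.
by apply: (leq_trans (size_scale_leq _ _)); rewrite size_bin_poly.
Qed.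

Lemma coef_hilbert_poly A : (hilbert_poly A)`_m = A.[1] / m`!%:R.
Proof.
rewrite /hilbert_poly coef_sum horner_coef mulr_suml; apply: eq_bigr => j _.
rewrite coefZ expr1n mulr1; have /monicP := bin_poly_monic j.
by rewrite lead_coefE size_bin_poly /= => ->; rewrite mulr1.
Qed.

End HilbertPolynomial.

Section Multiplicity.

Variables (k : fieldType) (N : nat) (J : {mpoly k[N]} -> Prop).
Hypothesis J_ideal : is_ideal J.
Variables (H : nat -> nat) (A : {poly rat}) (m : nat).
Hypothesis hilbertH : forall t, hilbert_value J t (H t).
Hypothesis H_series : forall t, (H t)%:R = conv A (inv_coef m) t.

Lemma is_multiplicity_series : A.[1] != 0 \/ A = 0 -> is_multiplicity J A.[1].
Proof.
move=> A1; case: m H_series => [|m'] HE.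
  exists H, 0, (size A); split=> // [t le|].
    by rewrite HE conv_delta horner0 nth_default.
  rewrite eqxx horner_coef natr_sum; apply: eq_bigr => j _.
  by rewrite expr1n mulr1 HE conv_delta.
exists H, (hilbert_poly m' A), (size A); split=> // [t le|].
  by rewrite HE hilbert_polyP.
case: A1 => [A1|A0].
  have lc : (hilbert_poly m' A)`_m' != 0.
    by rewrite coef_hilbert_poly mulf_neq0 // invr_neq0 ?fact_neq0.
  have sz : size (hilbert_poly m' A) = m'.+1.
    apply/eqP; rewrite eqn_leq size_hilbert_poly /= ltnNge; apply/negP => le.
    by rewrite nth_default ?eqxx in lc.
  rewrite -size_poly_eq0 sz /= lead_coefE sz /= coef_hilbert_poly.
  by rewrite mulrC divfK ?fact_neq0.
have -> : hilbert_poly m' A = 0.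
  by rewrite /hilbert_poly A0 size_poly0 big_ord0.
by rewrite eqxx A0 size_poly0 big_ord0 horner0.
Qed.

Lemma is_multiplicity_unique (x y : rat) :
  is_multiplicity J x -> is_multiplicity J y -> x = y.
Proof.
move=> [H1 [Q1 [t1 [h1 q1 ->]]]] [H2 [Q2 [t2 [h2 q2 ->]]]].
have HE t : H1 t = H2 t by exact: (hilbert_value_unique J_ideal (h1 t)).
have QE : Q1 = Q2.
  apply/eqP; rewrite -subr_eq0; apply/eqP/(@poly_eventually0 _ (maxn t1 t2)) => t.
  rewrite geq_max => /andP[le1 le2].
  by rewrite hornerD hornerN -q1 // -q2 // HE subrr.
rewrite -{}QE in q2 *; case: eqP => [Q0|//]; congr _%:R.
rewrite (eq_bigr (fun t : 'I_t1 => H2 t)) //.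
have sumE T T' : (forall t, (T <= t)%N -> H2 t = 0%N) -> (T <= T')%N ->
    (\sum_(t < T) H2 t = \sum_(t < T') H2 t)%N.
  move=> H0 le; rewrite (big_ord_widen _ _ le) big_mkcond; apply: eq_bigr => t _.
  by case: ltnP => // /H0.
have z1 t : (t1 <= t)%N -> H2 t = 0%N.
  by move/q1; rewrite Q0 horner0 HE => /eqP; rewrite pnatr_eq0 => /eqP.
have z2 t : (t2 <= t)%N -> H2 t = 0%N.
  by move/q2; rewrite Q0 horner0 => /eqP; rewrite pnatr_eq0 => /eqP.
by case: (leqP t1 t2) => [|/ltnW] le; [exact: sumE|symmetry; exact: sumE].
Qed.

(** For m > 0 and A(1) nonzero, the Hilbert polynomial has degree m - 1 and leading
    coefficient A(1) / (m - 1)!; for m = 0 the quotient has finite length A(1). If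
    A(1) = 0 but A is nonzero, the Hilbert polynomial has a smaller degree, and
    A(1) would not be the multiplicity. *)
Lemma multiplicity_series : A.[1] != 0 \/ A = 0 -> multiplicity J = A.[1].
Proof.
move=> /is_multiplicity_series mu; apply: (is_multiplicity_unique _ mu).
by apply: epsilon_spec; exists A.[1].
Qed.

End Multiplicity.

(** * Hilbert series of complete intersections *)

Section Series.

Variables (k : fieldType) (N : nat).
Notation R := {mpoly k[N]}.
Implicit Types (J K I : R -> Prop).

Lemma hilbert_value_iff J J' t h : is_ideal J -> is_ideal J' ->
  (forall p, J p <-> J' p) -> hilbert_value J t h -> hilbert_value J' t h.
Proof.
move=> idJ idJ' E /(hilbert_valueP _ _ idJ)[b [bt bS bI]].
apply/(hilbert_valueP _ _ idJ'); exists b; split=> // [p /bS[c /E]|c /E/bI //].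
by exists c.
Qed.

(** A constant is 0 or a unit, and neither occurs in a regular sequence. *)
Lemma regular_not_const n (f : 'I_n -> R) i :
  regular_sequence f -> ~ f i \is 0.-homog.
Proof.
move=> [reg nI] h0; apply: nI.
have fE : f i = ((f i)@_0%MM)%:MP.
  apply/mpolyP => m; rewrite mcoeffC; case: (eqVneq 0%MM m) => [<-|nm].
    by rewrite mulr1.
  by rewrite mulr0 (dhomog_nemf_coeff h0) // mdeg_eq0 eq_sym.
case: (eqVneq (f i)@_0%MM 0) => [f0|f0].
  have [|c ->] := reg i 1; first by rewrite mul1r fE f0; exact: ideal_gen0.
  apply: ideal_gen_sum => j _; apply: ideal_genM; exact: ideal_gen_in.
move: fE f0; set c := (f i)@_0%MM => fE c0.
have -> : 1 = (c^-1)%:MP * f i by rewrite fE -mpolyCM mulVf.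
by apply: ideal_genM; exact: ideal_gen_in.
Qed.

Lemma regular_nvars_gt0 n (f : 'I_n -> R) :
  (0 < n)%N -> regular_sequence f -> (0 < N)%N.
Proof.
move=> n_gt0 reg; rewrite lt0n; apply/eqP => N0.
by apply: (regular_not_const (i := Ordinal n_gt0) reg); exact: nvar0_homog_eq.
Qed.

Lemma regular_deg_gt0 n (f : 'I_n -> R) (d : 'I_n -> nat) i :
  regular_sequence f -> f i \is (d i).-homog -> (0 < d i)%N.
Proof.
move=> reg; rewrite lt0n => fd; apply/eqP => d0.
by apply: (regular_not_const (i := i) reg); move: fd; rewrite d0.
Qed.

Lemma hilbert_function_exists J : (0 < N)%N -> is_ideal J ->
  exists H, forall t, hilbert_value J t (H t).
Proof.
move=> N_gt0 idJ; apply: row_choice => t.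
by case: N N_gt0 J idJ => // N' _ J' ; exact: hilbert_value_exists.
Qed.

Lemma hilbert_quotient K J I (q : R) (dl : nat) (HK HI HJ : nat -> nat) :
  is_ideal K -> is_ideal J -> is_ideal I ->
  (forall z p, K p -> K (hpart z p)) -> q \is dl.-homog ->
  (forall p, J p <-> exists c, K (p - c * q)) ->
  (forall a, K (a * q) <-> I a) ->
  (forall t, hilbert_value K t (HK t)) -> (forall t, hilbert_value I t (HI t)) ->
  (forall t, hilbert_value J t (HJ t)) ->
  forall t, (HJ t)%:R = (HK t)%:R - conv 'X^dl (fun s => (HI s)%:R) t :> rat.
Proof.
move=> idK idJ idI Kh qd JE IE hK hI hJ t; rewrite conv_Xn.
case: leqP => [le|lt].
  have hJt : hilbert_value J (t - dl + dl) (HJ t) by rewrite subnK.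
  have := hilbert_value_add idK idJ idI Kh qd JE IE (hI _) hJt.
  by rewrite subnK // => /(hilbert_value_unique idK (hK t))->; rewrite natrD addrK.
have := hilbert_value_low idK idJ Kh qd JE lt (hJ t).
by move=> /(hilbert_value_unique idK (hK t))->; rewrite subr0.
Qed.

(** Passing from i to i + 1 elements multiplies the Hilbert series by
    1 - z^(d_i), as multiplication by f_i is injective modulo the previous ones. *)
Lemma hilbert_initial n (f : 'I_n -> R) (d : 'I_n -> nat) m :
  (0 < N)%N -> regular_sequence f -> (forall i, f i \is (d i).-homog) ->
  (m <= n)%N -> forall H : nat -> nat,
  (forall t, hilbert_value (ideal_gen [pred j : 'I_n | (j < m)%N] f) t (H t)) ->
  forall t, (H t)%:R
    = conv (\prod_(j < n | (j < m)%N) (1 - 'X^(d j))) (inv_coef N) t.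
Proof.
move=> N_gt0 reg fd; elim: m => [|m IHm] le_mn H hH t.
  rewrite big_pred0 // conv1.
  suff : hilbert_value (ideal_gen [pred j : 'I_n | (j < 0)%N] f) t 'C(t + N.-1, N.-1).
    move=> /(hilbert_value_unique (is_ideal_gen _ _) (hH t))->.
    by rewrite /inv_coef; case: N N_gt0.
  have : forall p, ideal_gen [pred j : 'I_n | (j < 0)%N] f p -> p = 0.
    by move=> p [c ->]; rewrite big_pred0.
  have := is_ideal_gen [pred j : 'I_n | (j < 0)%N] f.
  move: (ideal_gen _ _); case: N N_gt0 => // N' _ J' idJ' J0.
  by rewrite -bin_sub ?leq_addl // addnK; exact: hilbert_value0.
pose i := Ordinal le_mn.
have [HK hK] := hilbert_function_exists N_gt0
  (is_ideal_gen [pred j : 'I_n | (j < m)%N] f).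
rewrite (bigD1 i) //= convM convB conv1.
have E s : (HK s)%:R = conv (\prod_(j < n | (j < m.+1)%N && (j != i))
    (1 - 'X^(d j))) (inv_coef N) s :> rat.
  rewrite (IHm (ltnW le_mn) _ hK); congr conv; apply: eq_bigl => j.
  by rewrite ltnS ltn_neqAle andbC.
rewrite -E -(eq_conv _ E).
apply: (hilbert_quotient (q := f i) _ _ _ _ _ _ _ hK hK hH).
- exact: is_ideal_gen.
- exact: is_ideal_gen.
- exact: is_ideal_gen.
- exact: (ideal_gen_hpart fd).
- exact: fd.
- move=> p; split=> [/(ideal_gen_initialS (i := i))//|[c pc]].
  rewrite -(subrK (c * f i) p); apply: ideal_genD; last first.
    by apply/ideal_genM/ideal_gen_in => /=.
  case: pc => [c' ->]; apply: ideal_gen_sum => j jm.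
  by apply/ideal_genM/ideal_gen_in; rewrite /= ltnW.
move=> a; split; first exact: (reg.1 i).
by rewrite mulrC; exact: ideal_genM.
Qed.

Lemma hilbert_ideal n (f : 'I_n -> R) (d : 'I_n -> nat) (H : nat -> nat) :
  (0 < N)%N -> regular_sequence f -> (forall i, f i \is (d i).-homog) ->
  (forall t, hilbert_value (ideal f) t (H t)) ->
  forall t, (H t)%:R = conv (\prod_(j < n) (1 - 'X^(d j))) (inv_coef N) t.
Proof.
move=> N_gt0 reg fd hH t.
rewrite (hilbert_initial (H := H) N_gt0 reg fd (leqnn n)) => [|s].
  by congr conv; apply: eq_bigl => j; rewrite ltn_ord.
apply: hilbert_value_iff (hH s); [exact: is_ideal_ideal|exact: is_ideal_gen|].
exact: idealE.
Qed.

Definition geom d : {poly rat} := \sum_(j < d) 'X^j.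

Lemma geomE d : 1 - 'X^d = (1 - 'X) * geom d.
Proof. by rewrite -opprB subrX1 -mulNr opprB. Qed.

Lemma geom_horner1 d : (geom d).[1] = d%:R.
Proof.
rewrite horner_sum (eq_bigr (fun=> 1)) ?sumr_const ?card_ord //.
by move=> j _; rewrite hornerXn expr1n.
Qed.

Lemma geom_horner0 d : (0 < d)%N -> (geom d).[0] = 1.
Proof.
case: d => // d _; rewrite horner_sum big_ord_recl hornerXn expr0 big1 ?addr0 //.
by move=> j _; rewrite hornerXn expr0n.
Qed.

Lemma prod_geom n (d : 'I_n -> nat) :
  \prod_(j < n) (1 - 'X^(d j)) = (1 - 'X) ^+ n * \prod_(j < n) geom (d j).
Proof.
rewrite (eq_bigr _ (fun j _ => geomE (d j))) big_split /=.
by rewrite prodr_const card_ord.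
Qed.

(** If n > N, the Hilbert series of the complete intersection is a polynomial
    divisible by 1 - z, with nonnegative coefficients and constant term 1; its
    value at 1 would be zero and positive. *)
Lemma regular_length_le n (f : 'I_n -> R) (d : 'I_n -> nat) :
  (0 < N)%N -> regular_sequence f -> (forall i, f i \is (d i).-homog) ->
  (n <= N)%N.
Proof.
move=> N_gt0 reg fd; rewrite leqNgt; apply/negP => lt.
have [H hH] := hilbert_function_exists N_gt0 (is_ideal_ideal f).
pose P := (\prod_(j < n) geom (d j)) * (1 - 'X) ^+ (n - N).
have PE t : P`_t = (H t)%:R.
  rewrite (hilbert_ideal N_gt0 reg fd hH) prod_geom mulrC.
  have -> : (1 - 'X) ^+ n = (1 - 'X) ^+ (n - N) * (1 - 'X) ^+ N :> {poly rat}.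
    by rewrite -exprD subnK // ltnW.
  rewrite mulrA convM.
  rewrite -conv_delta; apply: eq_conv => s.
  by rewrite -[in inv_coef N](addn0 N) conv_inv_coefX.
have hornerX1 (x : rat) : (1 - 'X).[x] = 1 - x.
  by rewrite hornerD hornerN hornerX -polyC1 hornerC.
have P0 : P`_0 = 1.
  rewrite -horner_coef0 /P hornerM horner_exp hornerX1 subr0 expr1n mulr1.
  by rewrite horner_prod big1 // => j _; rewrite geom_horner0 // (regular_deg_gt0 reg).
have : P.[1] = 0.
  by rewrite /P hornerM horner_exp hornerX1 subrr expr0n subn_eq0 leqNgt lt /= mulr0.
rewrite horner_coef => /psumr_eq0P H0.
have sz : (0 < size P)%N.
  rewrite lt0n; apply/eqP => s0; have /eqP := P0.
  by rewrite nth_default ?s0 // eq_sym oner_eq0.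
have := H0 _ (Ordinal sz) isT; rewrite /= P0 expr1n mulr1 => /(_ _) F.
suff /F/eqP : forall i : 'I_(size P), true -> 0 <= P`_i * 1 ^+ i by rewrite oner_eq0.
by move=> i _; rewrite expr1n mulr1 PE ler0n.
Qed.

End Series.

(** * An inequality for the degrees *)

Section DegreeInequality.

(** The Weierstrass product inequality. *)
Lemma prod_sub_ge (I : finType) (P : pred I) (u : I -> rat) :
  (forall i, P i -> 0 <= u i <= 1) ->
  1 - \sum_(i | P i) u i <= \prod_(i | P i) (1 - u i).
Proof.
move=> u01; suff [] : 1 - \sum_(i | P i) u i <= \prod_(i | P i) (1 - u i)
    /\ 0 <= \prod_(i | P i) (1 - u i) <= 1 by [].
elim/big_rec2: _ => [|i x y Pi [xy y01]]; first by split; lra.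
by have := u01 i Pi; split; nra.
Qed.

(** With u_i = 1 - d_i/e, the hypothesis on the sum says that the u_i add up to at
    most 1; removing the largest one, u_(i0), leaves at most 1 - 1/n. *)
Lemma prod_degrees_ge n (d : 'I_n -> nat) (e : nat) (i0 : 'I_n) :
  (0 < e)%N -> (forall i, d i <= e)%N -> (forall i, d i0 <= d i)%N ->
  (n.-1 * e <= \sum_i d i)%N ->
  (e ^ n.-1 * d i0 <= n * \prod_i d i)%N.
Proof.
move=> e_gt0 de d0 sd.
have e0 : (0 : rat) < e%:R by rewrite ltr0n.
pose u i : rat := 1 - (d i)%:R / e%:R.
have uE i : (d i)%:R = e%:R * (1 - u i) by rewrite /u; field; rewrite lt0r_neq0.
have u01 i : 0 <= u i <= 1.
  rewrite /u subr_ge0 ler_pdivrMr // mul1r ler_nat de /=.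
  by rewrite lerBlDr lerDl divr_ge0 // ler0n.
have us : \sum_i u i <= 1.
  rewrite sumrB sumr_const card_ord -mulr_suml lerBlDr -lerBlDl ler_pdivlMr //.
  rewrite -natr_sum; apply: le_trans (_ : (n.-1 * e)%N%:R <= _).
    rewrite natrM ler_pM2r //; have := ltn_ord i0.
    case: n i0 {d de d0 sd u uE u01} => // n' _ _.
    by rewrite -natr1 /= lerBlDr; lra.
  by rewrite ler_nat.
have u0 i : u i <= u i0 by rewrite /u lerD2l lerN2 ler_pM2r ?invr_gt0 // ler_nat.
have nu : \sum_i u i <= n%:R * u i0.
  apply: le_trans (ler_sum _ (fun i _ => u0 i)) _.
  by rewrite sumr_const card_ord mulr_natl.
have n1 : 1 <= n%:R :> rat by rewrite ler1n; exact: leq_ltn_trans (ltn_ord i0).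
have W := prod_sub_ge (P := predC1 i0) (fun i _ => u01 i).
have key : 1 <= n%:R * \prod_(i | i != i0) (1 - u i).
  apply: le_trans (_ : n%:R * (1 - \sum_(i | i != i0) u i) <= _); last first.
    by rewrite ler_pM2l // (lt_le_trans ltr01).
  by move: us nu; rewrite (bigD1 i0) //=; nra.
rewrite -(ler_nat rat) !natrM natr_prod (bigD1 i0) //=.
rewrite [X in _ * (_ * X)](eq_bigr (fun i => e%:R * (1 - u i))) => [|i _];
  last exact: uE.
rewrite big_split /= prodr_const cardC1 card_ord natrX.
set p := \prod_(i | _) _ in key *.
have -> : n%:R * ((d i0)%:R * (e%:R ^+ n.-1 * p))
  = e%:R ^+ n.-1 * (d i0)%:R * (n%:R * p) :> rat by ring.
by apply: ler_peMr => //; rewrite mulr_ge0 ?exprn_ge0 ?ler0n.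
Qed.

End DegreeInequality.

(** * Grading of the dual mapping cone *)

Section GradedCone.

Variables (k : fieldType) (N n : nat).
Notation R := {mpoly k[N]}.
Implicit Types (S T A : {set 'I_n}).

Lemma homog_int0 z : homog_int z (0 : R).
Proof. by case: z => m //=; exact: dhomog0. Qed.

Lemma homog_intD z (p q : R) :
  homog_int z p -> homog_int z q -> homog_int z (p + q).
Proof. by case: z => m /=; [exact: rpredD|move=> -> ->; rewrite addr0]. Qed.

Lemma homog_intN z (p : R) : homog_int z p -> homog_int z (- p).
Proof. by case: z => m /=; [rewrite rpredN|move=> ->; rewrite oppr0]. Qed.

Lemma koszul_homog (f : 'I_n -> R) (d : 'I_n -> nat) S T :
  (forall i, f i \is (d i).-homog) ->
  homog_int ((\sum_(t in S) d t)%N%:Z - (\sum_(t in T) d t)%N%:Z) (koszul f S T).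
Proof.
move=> fd; apply: (big_ind (homog_int _)) => [||s /andP[sS /eqP ->]].
- exact: homog_int0.
- by move=> p q; exact: homog_intD.
rewrite (big_setD1 s) //= PoszD addrK /=.
by rewrite -signr_odd mulr_sign; case: odd => //; rewrite rpredN.
Qed.

Variables (f g : 'I_n -> R) (d : 'I_n -> nat) (e : nat).
Hypothesis f_homog : forall i, f i \is (d i).-homog.
Hypothesis g_homog : forall i, g i \is e.-homog.
Variable phi : {set 'I_n} -> {set 'I_n} -> R.
Hypothesis phi_map : koszul_map f g d e phi.

Notation P := (dual_mapping_cone f g d e phi).

Lemma cone_homog i (b : gidx P i.+1) (c : gidx P i) :
  homog_int (gshift b - gshift c) (gdiff b c).
Proof.
have [phi_card phi_homog _ _] := phi_map.
rewrite /=; case: (val b) => S; case: (val c) => T /=.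
- have := koszul_homog T S (d := fun=> e) g_homog; rewrite !sum_nat_const.
  by congr homog_int; ring.
- exact: homog_int0.
- case: (eqVneq #|T| #|S|) => [E|E]; last by rewrite phi_card //; exact: homog_int0.
  by have := phi_homog _ _ E; congr homog_int; ring.
apply: homog_intN; have := koszul_homog T S f_homog.
by congr homog_int; ring.
Qed.

Lemma cone_aug_homog (b : gidx P 0) : homog_int (gshift b) (1 : R).
Proof.
have := valP b; rewrite /=; case: (val b) => A /= /andP[_ /eqP]; rewrite addn0 => AE.
  by rewrite AE subrr /=; exact: dhomog1.
by have := card_le_n A; rewrite AE ltnn.
Qed.

End GradedCone.

(** * The multiplicity of the linked ideal *)

Section Link.

Variables (k : fieldType) (N n : nat).
Notation R := {mpoly k[N]}.
Variables (f g : 'I_n -> R) (d : 'I_n -> nat) (e : nat).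
Hypothesis n_gt0 : (0 < n)%N.
Hypothesis f_homog : forall i, f i \is (d i).-homog.
Hypothesis d_sorted : forall i j : 'I_n, (i <= j)%N -> (d i <= d j)%N.
Hypothesis f_regular : regular_sequence f.
Hypothesis g_homog : forall i, g i \is e.-homog.
Hypothesis g_regular : regular_sequence g.
Variable phi : {set 'I_n} -> {set 'I_n} -> R.
Hypothesis phi_map : koszul_map f g d e phi.

Notation Delta := (phi setT setT).
Notation J := (colon (ideal g) (ideal f)).

Let J_ideal : is_ideal J.
Proof. exact/is_ideal_colon/is_ideal_gen. Qed.

Lemma colon_adjoin_Delta p : J p <-> exists c, ideal g (p - c * Delta).
Proof.
by have [h1 _ h3 h4] := phi_map; apply: (colon_eq_adjoin_Delta f_regular g_regular).
Qed.

Lemma colon_DeltaE a : ideal g (a * Delta) <-> ideal f a.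
Proof.
have [h1 _ h3 h4] := phi_map; split=> [/(colon_Delta f_regular g_regular)|].
  exact.
exact: Delta_ideal.
Qed.

(** If e < d_n, then phi has, by degrees, no entry from g_i to f_n, so that K lies
    in the ideal I' of f_1, ..., f_(n-1). But Delta I' lies in K, so Delta lies in K
    by [colon_initial], and 1 lies in K : Delta = I. *)
Lemma degree_le i : (d i <= e)%N.
Proof.
have [phi_card phi_homog phi0 phiE] := phi_map.
have lt_last : (n.-1 < n)%N by rewrite prednK.
pose l := Ordinal lt_last.
apply: leq_trans (d_sorted (j := l) _) _; first by rewrite /= -ltnS prednK.
rewrite leqNgt; apply/negP => lt_e; apply: (f_regular.2).
have -> : ideal f 1 <-> ideal g (1 * Delta) by rewrite colon_DeltaE.
apply: (colon_initial f_regular g_regular lt_last) => [q [c ->]|q [c ->]].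
  apply: ideal_gen_sum => i' _; apply: ideal_genM.
  have := phiE [set i'] set0.
  have kz (h : 'I_n -> R) T : koszul h T set0 = \sum_(s | T == [set s]) h s.
    rewrite /koszul; apply: eq_big => s.
      rewrite eq_sym; apply/andP/eqP => [[sT /eqP E]|->].
        by rewrite -(setD1K sT) E setU0.
      by rewrite set11 setDv.
    move=> /andP[sT /eqP E].
    have -> : [set t in T | (t < s)%N] = set0.
      apply/setP=> t; rewrite !inE; case: (eqVneq t s) => [->|ts].
        by rewrite ltnn andbF.
      have := in_set0 t; rewrite E !inE ts /= => ->.
      by [].
    by rewrite cards0 mul1r.
  have -> : \sum_T koszul g [set i'] T * phi T set0 = g i'.
    rewrite (bigD1 set0) //= phi0 mulr1 big1 ?addr0 => [|T T0].
      rewrite kz (big_pred1 i') // => s; by rewrite (inj_eq set1_inj) eq_sym.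
    by rewrite phi_card ?mulr0 // cards0 cards_eq0.
  move=> <-; apply: ideal_gen_sum => T _; rewrite kz big_distrr /=.
  apply: ideal_gen_sum => s /eqP TE.
  case: (ltnP s n.-1) => [lt|ge].
    by apply: ideal_genM; exact: ideal_gen_in.
  have sl : s = l.
    by apply/val_inj/eqP; rewrite eqn_leq /= ge andbT -ltnS prednK.
  have := phi_homog [set i'] T; rewrite TE sl !cards1 => /(_ erefl).
  rewrite big_set1 mul1n; case E : (_ - _) => [m|m] /=; first by lia.
  by move=> ->; rewrite mul0r; exact: ideal_gen0.
rewrite mul1r mulrC; apply/colon_DeltaE; apply: ideal_gen_sum => j _.
by apply: ideal_genM; exact: ideal_gen_in.
Qed.

(** The degree ne - (d_1 + ... + d_n) is nonnegative because Delta is nonzero: it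
    does not even lie in K. *)
Lemma Delta_homog :
  exists2 dl, (n * e = \sum_i d i + dl)%N & Delta \is dl.-homog.
Proof.
have [_ phi_homog _ _] := phi_map; have := phi_homog setT setT erefl.
rewrite cardsT card_ord.
have -> : (\sum_(t in [set: 'I_n]) d t = \sum_i d i)%N.
  by apply: eq_bigl => i; rewrite inE.
case E : (_ - _) => [dl|m] /= h.
  by exists dl => //; apply/eqP; rewrite -eqz_nat PoszD -E addrC subrK.
case: (f_regular.2); apply/colon_DeltaE; rewrite h mulr0; exact: ideal_gen0.
Qed.

(** When all d_i are equal to e the numerator of the Hilbert series is 0;
    otherwise d_1 ... d_n < e^n and its value at 1 is nonzero. *)
Lemma multiplicity_colon :
  multiplicity J = (e ^ n)%N%:R - (\prod_i d i)%N%:R.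
Proof.
have N_gt0 := regular_nvars_gt0 n_gt0 f_regular.
have le_nN := regular_length_le N_gt0 f_regular f_homog.
have [dl dlE Dh] := Delta_homog.
have [H hH] := hilbert_function_exists N_gt0 J_ideal.
have [HK hK] := hilbert_function_exists N_gt0 (is_ideal_ideal g).
have [HI hI] := hilbert_function_exists N_gt0 (is_ideal_ideal f).
pose A : {poly rat} :=
  \prod_(j < n) geom e - 'X^dl * \prod_(j < n) geom (d j).
have A1 : A.[1] = (e ^ n)%N%:R - (\prod_i d i)%N%:R.
  rewrite /A hornerD hornerN hornerM hornerXn expr1n mul1r !horner_prod.
  rewrite natr_prod; congr (_ - _); last first.
    by apply: eq_bigr => j _; rewrite geom_horner1.
  by rewrite (eq_bigr (fun=> e%:R)) ?prodr_const ?card_ord ?natrX // => j _;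
    rewrite geom_horner1.
rewrite -A1; apply: (multiplicity_series J_ideal hH (m := N - n)).
  move=> t; rewrite (hilbert_quotient (is_ideal_ideal g) J_ideal (is_ideal_ideal f)
    _ Dh colon_adjoin_Delta colon_DeltaE hK hI hH); last first.
    by move=> z p; exact: (ideal_gen_hpart g_homog).
  rewrite (hilbert_ideal N_gt0 g_regular g_homog hK).
  rewrite (eq_conv _ (hilbert_ideal N_gt0 f_regular f_homog hI)).
  rewrite -convM -convB !prod_geom mulrCA -mulrBr -/A mulrC convM.
  apply: eq_conv => s; rewrite -[in inv_coef N](subnKC le_nN).
  exact: conv_inv_coefX.
have e_gt0 : (0 < e)%N.
  exact: (regular_deg_gt0 (i := Ordinal n_gt0) g_regular).
have [/forallP de|] := boolP [forall i, d i == e].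
  right; rewrite /A; have -> : dl = 0%N.
    move: dlE; rewrite (eq_bigr (fun=> e)) => [|i _]; last exact/eqP/de.
    rewrite sum_nat_const card_ord => /eqP.
    by rewrite -[X in X == _]addn0 eqn_add2l => /eqP.
  rewrite mul1r (eq_bigr (fun j => geom (d j))) ?subrr // => j _.
  by rewrite (eqP (de j)).
rewrite negb_forall => /existsP[i di]; left.
rewrite A1 subr_eq0 eqr_nat gtn_eqF //.
rewrite (bigD1 i) //=.
have -> : (e ^ n = e * e ^ n.-1)%N by rewrite -expnS prednK.
apply: (@leq_trans (e * \prod_(j < n | j != i) d j)).
  rewrite ltn_pmul2r; first by rewrite ltn_neqAle di degree_le.
  apply: prodn_cond_gt0 => j _; exact: (regular_deg_gt0 f_regular (f_homog j)).
rewrite leq_pmul2l // (_ : (e ^ n.-1 = \prod_(j < n | j != i) e)%N).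
  by apply: leq_prod => j _; exact: degree_le.
by rewrite prod_nat_const cardC1 card_ord.
Qed.

End Link.

(** * The bound *)

Theorem theorem4p5 (k : fieldType) (N n : nat) (n_ge2 : (2 <= n)%N)
  (f : 'I_n -> {mpoly k[N]}) (d : 'I_n -> nat)
  (f_homog : forall i, f i \is (d i).-homog)
  (d_sorted : forall i j : 'I_n, (i <= j)%N -> (d i <= d j)%N)
  (f_regular : regular_sequence f)
  (g : 'I_n -> {mpoly k[N]}) (e : nat)
  (g_homog : forall i, g i \is e.-homog)
  (g_regular : regular_sequence g)
  (K_sub_I : forall p, ideal g p -> ideal f p)
  (phi : {set 'I_n} -> {set 'I_n} -> {mpoly k[N]})
  (phi_map : koszul_map f g d e phi)
  (P_minimal : minimal (dual_mapping_cone f g d e phi))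
  (F : gfree_seq k N)
  (F_resolution : graded_free_resolution F (colon (ideal g) (ideal f)))
  (F_minimal : minimal F)
  (M : nat -> int)
  (M_max : forall i, (1 <= i <= n)%N -> is_max_shift F i (M i))
  (M1 : M 1%N = e%:Z) :
  multiplicity (colon (ideal g) (ideal f))
    <= (\prod_(1 <= i < n.+1) M i)%:~R / n`!%:R.
Proof.
have n_gt0 : (0 < n)%N := ltnW n_ge2.
have [phi_card _ phi0 phiE] := phi_map.
have [F_homog [aF [aF_homog F1 F2 F3]]] := F_resolution.
have shiftP i (x : {set 'I_n} + {set 'I_n}) :
    (0 < i <= n)%N -> cone_basis i x -> cone_shift d e x <= M i.
  case: i => // i le_in Bx.
  have [c cE] := minimal_shift (is_ideal_colon (ideal f) (is_ideal_ideal g))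
    (colon_hpart f_homog g_homog)
    (cone_resolves f_regular g_regular n_gt0 phi_card phi0 phiE d e)
    (And3 F1 F2 F3) (cone_homog f_homog g_homog phi_map) F_homog
    (fun b => cone_aug_homog b) aF_homog P_minimal (exist _ x Bx).
  by rewrite -[cone_shift d e x]cE; exact: (M_max _ le_in).2.
(* In the cone, the dual of e_A with #|A| = n - i gives the shift ie in degree i,
   the singleton of [i0] the shift ne - d_1 in degree n, and the full set the
   shift ne - (d_1 + ... + d_n) in degree 1. *)
have subset_card m : (m <= n)%N -> exists A : {set 'I_n}, #|A| = m.
  by move=> le; exists (initial m); rewrite card_initial.
have Mi i : (0 < i < n)%N -> (i * e)%N%:Z <= M i.
  move=> /andP[i_gt0 lt_in]; have [A AE] := subset_card _ (leq_subr i n).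
  have := shiftP i (inl A); rewrite /= i_gt0 (ltnW lt_in) AE subnK ?(ltnW lt_in) //.
  rewrite eqxx andbT -card_gt0 AE subn_gt0 lt_in mulnBl => /(_ isT isT).
  apply: le_trans; rewrite subzn ?leq_subr // subKn //.
  by rewrite leq_mul2r (ltnW lt_in) orbT.
pose i0 := Ordinal n_gt0.
have Mn : (n * e)%N%:Z - (d i0)%:Z <= M n.
  have := shiftP n (inr [set i0]).
  by rewrite /= n_gt0 leqnn -card_gt0 cards1 add1n eqxx big_set1; exact.
have sum_d : (n.-1 * e <= \sum_i d i)%N.
  have := shiftP 1%N (inr setT); rewrite /= n_gt0 cardsT card_ord addn1 eqxx andbT.
  rewrite M1 (eq_bigl xpredT) => [|i]; last by rewrite inE.
  rewrite -card_gt0 cardsT card_ord => /(_ isT n_gt0).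
  by rewrite -[X in (X * e)%N](prednK n_gt0) mulSn lerBlDr -PoszD lez_nat leq_add2l.
have e_gt0 : (0 < e)%N by exact: (regular_deg_gt0 (i := i0) g_regular).
have de := degree_le n_gt0 d_sorted f_regular g_regular phi_map.
have key := prod_degrees_ge e_gt0 de (fun i => d_sorted i0 i (leq0n i)) sum_d.
rewrite (multiplicity_colon n_gt0 f_homog d_sorted f_regular g_homog g_regular
  phi_map).
rewrite ler_pdivlMr ?ltr0n ?fact_gt0 //.
rewrite big_nat_recr //=.
have low : ((n.-1)`! * e ^ n.-1 * (n * e - d i0))%N%:Z
    <= \prod_(1 <= i < n) M i * M n.
  rewrite PoszM; apply: ler_pM => //.
    have -> : ((n.-1)`! * e ^ n.-1)%N = (\prod_(1 <= i < n) (i * e))%N.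
      by rewrite big_split /= prod_nat_const_nat fact_prod prednK // subn1.
    rewrite (big_morph Posz PoszM (erefl _)) !big_nat.
    by apply: ler_prod => i /Mi ->.
  by rewrite -subzn //; apply: leq_trans (de i0) _; rewrite leq_pmull.
apply: le_trans (_ : ((n.-1)`! * e ^ n.-1 * (n * e - d i0))%N%:R <= _); last first.
  by rewrite pmulrn ler_int.
have -> : n`! = (n * (n.-1)`!)%N by rewrite -[in LHS](prednK n_gt0) factS prednK.
have le_d0 : (d i0 <= n * e)%N by apply: leq_trans (de i0) _; rewrite leq_pmull.
have eS : (e ^ n = e * e ^ n.-1)%N by rewrite -expnS prednK.
rewrite -(ler_nat rat) in key; rewrite eS !natrM (natrB _ le_d0) !natrM in key *.
move: key; set p := (\prod_i d i)%N%:R; set q := (e ^ n.-1)%N%:R => key.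
have f_gt0 : 0 <= ((n.-1)`!)%:R :> rat by rewrite ler0n.
nra.
Qed.
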